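(* Let $F$ be a field of characteristic $\neq 2$. If $H^2_u(F)=0$, then $F$ is tractable.
   Context: A field $F$ of characteristic $\neq 2$ is tractable if for every $a_1,a_2,a_3,b_1,b_2,b_3\in F^\times$ such that the six quaternion algebras $(a_i,b_j)$ are split for all $i\ne j$ and the three quaternion algebras $(a_i,b_i)$ are pairwise isomorphic, the algebras $(a_i,b_i)$ are necessarily split. Write $H^d(F)$ for the Galois cohomology group $H^d(F,\mathbb{Z}/2\mathbb{Z})$; $H^2(F)$ is identified with the 2-torsion of the Brauer group of $F$. A discrete valuation is dyadic if its residue field has characteristic 2, and nondyadic otherwise. For a nondyadic discrete valuation $v$ on $F$ with uniformizer $\pi$ and residue field $\bar F$, there is the usual residue homomorphism $\partial_v\colon H^d(F)\to H^{d-1}(\bar F)$, characterized by $\partial_v((u_1)\cdots(u_d))=0$ and $\partial_v((\pi)\cdot(u_2)\cdots(u_d))=(\bar u_2)\cdots(\bar u_d)$ for $u_i$ of value 0; a class is unramified at $v$ if it lies in the kernel of $\partial_v$. For $d\ge 2$, $H^d_u(F)$ is the subgroup of $H^d(F)$ consisting of classes that are unramified at every nondyadic discrete valuation of $F$ and are killed by $H^d(F)\to H^d(R)$ for every real closure $R$ of $F$ (with respect to an ordering of $F$). *)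

(* Defs.v *)
From HB Require Import structures.
From mathcomp Require Import all_boot all_order all_algebra all_field.
From mathcomp Require Import boolp classical_sets functions.
From mathcomp Require Import ring.

Set Implicit Arguments.
Unset Strict Implicit.
Unset Printing Implicit Defensive.

Import Order.TTheory GRing.Theory Num.Theory.

Local Open Scope ring_scope.
Local Open Scope quotient_scope.

(* [quat a b] has basis 1, i, j, k = ij with i^2 = a, j^2 = b, ji = -ij, the
   coordinates being numbered 0, 1, 2, 3.  It is used for a, b != 0. *)
Definition quat (F : fieldType) (a b : F) : Type := 'rV[F]_4.

Section QuatRing.
Variables (F : fieldType) (a b : F).
Local Notation Q := (quat a b).

HB.instance Definition _ := GRing.Lmodule.copy Q 'rV[F]_4.

Definition mkquat (x0 x1 x2 x3 : F) : Q :=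
  \row_(i < 4) [:: x0; x1; x2; x3]`_i.

Definition qc (x : Q) (i : nat) : F := x 0 (inord i).

Definition quat_one : Q := mkquat 1 0 0 0.

Definition quat_mul (x y : Q) : Q :=
  let: (x0, x1, x2, x3) := (qc x 0, qc x 1, qc x 2, qc x 3) in
  let: (y0, y1, y2, y3) := (qc y 0, qc y 1, qc y 2, qc y 3) in
  mkquat
    (x0 * y0 + a * (x1 * y1) + b * (x2 * y2) - a * b * (x3 * y3))
    (x0 * y1 + x1 * y0 - b * (x2 * y3) + b * (x3 * y2))
    (x0 * y2 + x2 * y0 + a * (x1 * y3) - a * (x3 * y1))
    (x0 * y3 + x3 * y0 + x1 * y2 - x2 * y1).

Lemma quatP (x y : Q) :
  qc x 0 = qc y 0 -> qc x 1 = qc y 1 -> qc x 2 = qc y 2 -> qc x 3 = qc y 3 ->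
  x = y.
Proof.
move=> h0 h1 h2 h3; apply/rowP => i; rewrite -[i]inord_val.
by case: i => [[|[|[|[|i]]]] Hi].
Qed.

Lemma qc_mk x0 x1 x2 x3 :
  ((qc (mkquat x0 x1 x2 x3) 0 = x0) * (qc (mkquat x0 x1 x2 x3) 1 = x1)) *
  ((qc (mkquat x0 x1 x2 x3) 2 = x2) * (qc (mkquat x0 x1 x2 x3) 3 = x3)).
Proof. by do !split; rewrite /qc mxE inordK. Qed.

Lemma qcD (x y : Q) i : qc (x + y) i = qc x i + qc y i.
Proof. by rewrite /qc mxE. Qed.

Lemma qcZ (c : F) (x : Q) i : qc (c *: x) i = c * qc x i.
Proof. by rewrite /qc mxE. Qed.

Lemma qc0 i : qc (0 : Q) i = 0.
Proof. by rewrite /qc mxE. Qed.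

End QuatRing.

Section QuatAlg.
Variables (F : fieldType) (a b : F).
Local Notation Q := (quat a b).

Fact quat_mulA : associative (@quat_mul F a b).
Proof. by move=> x y z; apply: quatP; rewrite /quat_mul !qc_mk; ring. Qed.

Fact quat_mul1 : left_id (@quat_one F a b) (@quat_mul F a b).
Proof. by move=> x; apply: quatP; rewrite /quat_mul /quat_one !qc_mk; ring. Qed.

Fact quat_mul1r : right_id (@quat_one F a b) (@quat_mul F a b).
Proof. by move=> x; apply: quatP; rewrite /quat_mul /quat_one !qc_mk; ring. Qed.

Fact quat_mulDl : left_distributive (@quat_mul F a b) +%R.
Proof. by move=> x y z; apply: quatP; rewrite /quat_mul ?(qcD, qc_mk); ring. Qed.

Fact quat_mulDr : right_distributive (@quat_mul F a b) +%R.
Proof. by move=> x y z; apply: quatP; rewrite /quat_mul ?(qcD, qc_mk); ring. Qed.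

Fact quat_one_neq0 : @quat_one F a b != 0.
Proof.
apply/eqP => /(congr1 (fun x : Q => qc x 0)).
by rewrite /quat_one qc_mk qc0 => /eqP; rewrite oner_eq0.
Qed.

HB.instance Definition _ := GRing.Zmodule_isNzRing.Build Q
  quat_mulA quat_mul1 quat_mul1r quat_mulDl quat_mulDr quat_one_neq0.

Fact quat_scaleAl (c : F) (x y : Q) : c *: (x * y) = (c *: x) * y.
Proof. by apply: quatP; rewrite /GRing.mul /= /quat_mul ?(qcZ, qc_mk); ring. Qed.

HB.instance Definition _ := GRing.Lmodule_isLalgebra.Build F Q quat_scaleAl.

Fact quat_scaleAr (c : F) (x y : Q) : c *: (x * y) = x * (c *: y).
Proof. by apply: quatP; rewrite /GRing.mul /= /quat_mul ?(qcZ, qc_mk); ring. Qed.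

HB.instance Definition _ := GRing.Lalgebra_isAlgebra.Build F Q quat_scaleAr.

End QuatAlg.

Definition alg_isom (F : fieldType) (A B : algType F) : Prop :=
  exists f : {lrmorphism A -> B}, bijective f.

Definition quat_split (F : fieldType) (a b : F) : Prop :=
  alg_isom (quat a b) 'M[F]_2.

(* To be used for fields of characteristic different from 2. *)
Definition tractable (F : fieldType) : Prop :=
  forall a b : 'I_3 -> F,
    (forall i, a i != 0) -> (forall i, b i != 0) ->
    (forall i j, i != j -> quat_split (a i) (b j)) ->
    (forall i j, alg_isom (quat (a i) (b i)) (quat (a j) (b j))) ->
    forall i, quat_split (a i) (b i).

Record sepClosure (F : fieldType) := SepClosure {
  sepclosure_field :> fieldType;
  sepclosure_in : {rmorphism F -> sepclosure_field};
  sepclosure_separable : forall x : sepclosure_field,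
    exists2 p : {poly F}, separable_poly p & root (map_poly sepclosure_in p) x;
  sepclosure_closed : forall p : {poly sepclosure_field},
    separable_poly p -> (1 < size p)%N -> exists x, root p x
}.
Arguments sepclosure_in {F} s.

Section AbsoluteGalois.
Variables (F : fieldType) (K : sepClosure F).

Definition gal_prop (s : K -> K) : Prop :=
  [/\ forall x y, s (x + y) = s x + s y,
      forall x y, s (x * y) = s x * s y,
      bijective s
    & forall a, s (sepclosure_in K a) = sepclosure_in K a].

Record gal := Gal { gal_fun :> K -> K; _ : `[< gal_prop gal_fun >] }.

HB.instance Definition _ := [isSub for gal_fun].
HB.instance Definition _ := gen_eqMixin gal.
HB.instance Definition _ := gen_choiceMixin gal.

Lemma galP (s : gal) : gal_prop s.
Proof. by apply/asboolP; case: s. Qed.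

Lemma gal_ext (s t : gal) : (forall x, s x = t x) -> s = t.
Proof. by move=> st; apply: val_inj; apply/funext. Qed.

Definition mk_gal (s : K -> K) (hs : gal_prop s) : gal := Gal (asboolT hs).

Fact gal_zmod_morphism (s : gal) : zmod_morphism s.
Proof.
have [sD _ _ _] := galP s; move=> x y.
by apply: (addIr (s y)); rewrite -sD !subrK.
Qed.
HB.instance Definition _ (s : gal) :=
  GRing.isZmodMorphism.Build K K (gal_fun s) (@gal_zmod_morphism s).

Fact gal_monoid_morphism (s : gal) : monoid_morphism s.
Proof.
have [_ sM _ s_in] := galP s; split; last exact: sM.
by rewrite -(rmorph1 (sepclosure_in K)) s_in.
Qed.
HB.instance Definition _ (s : gal) :=
  GRing.isMonoidMorphism.Build K K (gal_fun s) (@gal_monoid_morphism s).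

Lemma gal_in (s : gal) a : s (sepclosure_in K a) = sepclosure_in K a.
Proof. by have [_ _ _] := galP s. Qed.

Lemma gal_bij (s : gal) : bijective s.
Proof. by have [_ _ ? _] := galP s. Qed.

Fact gal_one_subproof : gal_prop id.
Proof. by split => //; exists id. Qed.
Definition gal_one : gal := mk_gal gal_one_subproof.

Fact gal_mul_subproof (s t : gal) : gal_prop (s \o t).
Proof.
split => [x y|x y||a] /=; rewrite ?rmorphD ?rmorphM ?gal_in //.
by apply: bij_comp; apply: gal_bij.
Qed.
Definition gal_mul (s t : gal) : gal := mk_gal (gal_mul_subproof s t).

Fact gal_inv_subproof (s : gal) : {g | cancel s g /\ cancel g s}.
Proof. by apply: cid; case: (gal_bij s) => g sK gK; exists g. Qed.

Fact gal_inv_prop (s : gal) : gal_prop (sval (gal_inv_subproof s)).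
Proof.
case: (gal_inv_subproof s) => g [/= sK gK]; split => [x y|x y||a] /=.
- by apply: (can_inj sK); rewrite rmorphD /= !gK.
- by apply: (can_inj sK); rewrite rmorphM /= !gK.
- by exists s.
- by rewrite -{1}(gal_in s a) sK.
Qed.
Definition gal_inv (s : gal) : gal := mk_gal (gal_inv_prop s).

Fact gal_mulA : associative gal_mul.
Proof. by move=> s t u; apply: gal_ext. Qed.
Fact gal_mul1 : left_id gal_one gal_mul.
Proof. by move=> s; apply: gal_ext. Qed.
Fact gal_mul1r : right_id gal_one gal_mul.
Proof. by move=> s; apply: gal_ext. Qed.
Fact gal_mulV : left_inverse gal_one gal_inv gal_mul.
Proof.
move=> s; apply: gal_ext => x /=.
by case: (gal_inv_subproof s) => g [/= sK gK].
Qed.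
Fact gal_mulVr : right_inverse gal_one gal_inv gal_mul.
Proof.
move=> s; apply: gal_ext => x /=.
by case: (gal_inv_subproof s) => g [/= sK gK].
Qed.
HB.instance Definition _ := isGroup.Build gal
  gal_mulA gal_mul1 gal_mul1r gal_mulV gal_mulVr.

Lemma galM (s t : gal) x : (s * t)%g x = s (t x).
Proof. by []. Qed.

End AbsoluteGalois.

Section Cohomology.
Variables (F : fieldType) (K : sepClosure F).
Local Notation G := (gal K).

Definition cochain (d : nat) : Type := ('I_d -> G) -> 'F_2.
HB.instance Definition _ d := GRing.Zmodule.copy (cochain d)
  (('I_d -> G) -> 'F_2).

(* Local constancy for the Krull topology: the elements of G agreeing with a
   given one on a finite subset S of K form a basic neighborhood of it. *)
Definition continuous_cochain d (f : cochain d) : Prop :=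
  forall s : 'I_d -> G, exists S : seq K, forall t : 'I_d -> G,
    (forall i, {in S, t i =1 s i}) -> f t = f s.

(* face 0 (s_0, ..., s_d) = (s_1, ..., s_d),
   face i (s_0, ..., s_d) = (s_0, ..., s_{i-1} s_i, ..., s_d) for 0 < i <= d,
   face d.+1 (s_0, ..., s_d) = (s_0, ..., s_{d-1}). *)
Definition face d (i : nat) (s : 'I_d.+1 -> G) : 'I_d -> G := fun k =>
  if (k.+1 < i)%N then s (lift ord_max k)
  else if k.+1 == i then (s (lift ord_max k) * s (lift ord0 k))%g
  else s (lift ord0 k).

(* The action on Z/2 is trivial, and so are the signs. *)
Definition dcochain d (f : cochain d) : cochain d.+1 :=
  fun s => \sum_(i < d.+2) f (face i s).

Definition cocycle d : {pred cochain d} :=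
  fun f => `[< continuous_cochain f /\ dcochain f = 0 >].

Lemma continuous_cochainB d (f g : cochain d) :
  continuous_cochain f -> continuous_cochain g -> continuous_cochain (f - g).
Proof.
move=> cf cg s; have [S1 h1] := cf s; have [S2 h2] := cg s.
exists (S1 ++ S2) => t ht.
have e1 : f t = f s by apply: h1 => i x xS; apply: ht; rewrite mem_cat xS.
have e2 : g t = g s.
  by apply: h2 => i x xS; apply: ht; rewrite mem_cat xS orbT.
by rewrite /GRing.add /GRing.opp /= /GRing.add_fun /GRing.opp_fun e1 e2.
Qed.

Lemma dcochainB d (f g : cochain d) :
  dcochain (f - g) = dcochain f - dcochain g.
Proof.
apply/funext => s; rewrite /dcochain /= !fctE /=.
by rewrite -sumrB; apply: eq_bigr => i _.
Qed.

Lemma continuous_cochain0 d : continuous_cochain (0 : cochain d).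
Proof. by move=> s; exists [::]. Qed.

Lemma dcochain0 d : dcochain (0 : cochain d) = 0.
Proof. by rewrite -(subrr (0 : cochain d)) dcochainB subrr. Qed.

Fact cocycle_zmod_closed d : zmod_closed (@cocycle d).
Proof.
split; first by apply/asboolP; rewrite dcochain0; split=> //; apply: continuous_cochain0.
move=> f g /asboolP[cf df] /asboolP[cg dg]; apply/asboolP; split.
  exact: continuous_cochainB.
by rewrite dcochainB df dg subrr.
Qed.
HB.instance Definition _ d :=
  GRing.isZmodClosed.Build (cochain d) (@cocycle d) (@cocycle_zmod_closed d).

Record Z d := Cocycle { cocycle_fun :> cochain d; _ : cocycle_fun \in @cocycle d }.
HB.instance Definition _ d := [isSub for @cocycle_fun d].
HB.instance Definition _ d := [Choice of Z d by <:].
HB.instance Definition _ d := [SubChoice_isSubZmodule of Z d by <:].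

Definition coboundary d : {pred Z d} :=
  match d with
  | 0 => fun f => f == 0
  | d'.+1 => fun f => `[< exists2 g : cochain d', continuous_cochain g
                            & f = dcochain g :> cochain d'.+1 >]
  end.

Fact coboundary_zmod_closed d : zmod_closed (@coboundary d).
Proof.
case: d => [|d]; split.
- exact: eqxx.
- by move=> f g /eqP-> /eqP->; rewrite subr0; apply/eqP.
- apply/asboolP; exists 0; first exact: continuous_cochain0.
  by rewrite dcochain0.
- move=> f g /asboolP[f' cf' ef] /asboolP[g' cg' eg]; apply/asboolP.
  exists (f' - g'); first exact: continuous_cochainB.
  by rewrite dcochainB -ef -eg.
Qed.
HB.instance Definition _ d :=
  GRing.isZmodClosed.Build (Z d) (@coboundary d) (@coboundary_zmod_closed d).

Definition H d : zmodType := {ideal_quot (@coboundary d)}.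

End Cohomology.

Section Symbols.
Variables (F : fieldType) (K : sepClosure F).
Local Notation iota := (sepclosure_in K).

(* The class (u) in H^1: s |-> 0 if s fixes the square roots of u, else 1. *)
Definition kummer (u : F) (s : gal K) : 'F_2 :=
  if `[< forall y : K, y ^+ 2 = iota u -> s y = y >] then 0 else 1.

Lemma kummerE (u : F) (y : K) (s : gal K) :
  y ^+ 2 = iota u -> kummer u s = (s y != y)%:R.
Proof.
move=> yu; rewrite /kummer; case: asboolP => h.
  by rewrite h ?eqxx.
case: eqP => // sy; exfalso; apply: h => z; rewrite -yu => /eqP.
by rewrite eqf_sqr => /orP[] /eqP ->; rewrite ?rmorphN /= sy.
Qed.

Lemma kummer_triv (u : F) (s : gal K) :
  ~ (exists y : K, y ^+ 2 = iota u) -> kummer u s = 0.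
Proof.
move=> h; rewrite /kummer; case: asboolP => // -[]; move=> y yu.
by case: h; exists y.
Qed.

Lemma addFF2 (x : 'F_2) : x + x = 0.
Proof. by case: x => [[|[|x]] hx] //; apply: val_inj. Qed.

Lemma kummerM (u : F) (s t : gal K) :
  kummer u (s * t)%g = kummer u s + kummer u t.
Proof.
have [[y yu]|h] := pselect (exists y : K, y ^+ 2 = iota u); last first.
  by rewrite !kummer_triv // addr0.
rewrite !(kummerE _ yu) galM.
have root_gal (r : gal K) : r y = y \/ r y = - y.
  have : r y ^+ 2 = y ^+ 2 by rewrite -rmorphXn /= yu gal_in.
  by move/eqP; rewrite eqf_sqr => /orP[] /eqP; [left | right].
have [->|->] := root_gal t; first by rewrite eqxx addr0.
rewrite rmorphN /=; have [->|->] := root_gal s; first by rewrite eqxx add0r.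
by rewrite opprK eqxx addFF2.
Qed.

(* A cocycle for the cup product (u_0) ... (u_{d-1}). *)
Definition symbol_cochain d (u : 'I_d -> F) : cochain K d :=
  fun s => \prod_(i < d) kummer (u i) (s i).

Lemma symbol_continuous d (u : 'I_d -> F) :
  continuous_cochain (symbol_cochain u).
Proof.
have /choice[y hy] : forall i, exists y : K,
    (exists z : K, z ^+ 2 = iota (u i)) -> y ^+ 2 = iota (u i).
  move=> i.
  have [[z zu]|h] := pselect (exists z : K, z ^+ 2 = iota (u i)).
    by exists z.
  by exists 0.
move=> s; exists [seq y i | i <- enum 'I_d] => t ts.
apply: eq_bigr => i _.
have [h|h] := pselect (exists z : K, z ^+ 2 = iota (u i)); last first.
  by rewrite !kummer_triv.
rewrite !(kummerE _ (hy i h)) (ts i) //.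
by apply/mapP; exists i; rewrite ?mem_enum.
Qed.

Lemma symbol_cocycle d (u : 'I_d -> F) : dcochain (symbol_cochain u) = 0.
Proof.
apply/funext => s; rewrite /dcochain /symbol_cochain.
pose A (j : nat) := \prod_(k < d)
  kummer (u k) (if (k < j)%N then s (lift ord_max k) else s (lift ord0 k)).
have E0 : \prod_(k < d) kummer (u k) (face 0 s k) = A 0%N.
  by apply: eq_bigr => k _; rewrite /face.
have Ed : \prod_(k < d) kummer (u k) (face d.+1 s k) = A d.
  by apply: eq_bigr => k _; rewrite /face ltnS ltn_ord.
have Ei (j : 'I_d) :
    \prod_(k < d) kummer (u k) (face j.+1 s k) = A j + A j.+1.
  rewrite (bigD1 j) //= /A [in RHS](bigD1 j) //= [X in _ + X](bigD1 j) //=.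
  rewrite {1}/face !ltnn !ltnSn eqxx kummerM mulrDl addrC.
  by congr (_ * _ + _ * _); apply: eq_bigr => k kj;
    rewrite /face !ltnS eqSS [in LHS]ltn_neqAle ?[in RHS]ltn_neqAle;
    rewrite (negPf kj : (k == j :> nat) = false) /=; case: ltngtP.
rewrite big_ord_recl big_ord_recr /= E0 [X in _ + (_ + X)]Ed.
under eq_bigr => j _ do rewrite Ei.
rewrite big_split /=.
suff e : A 0%N + \sum_(i < d) A i.+1 = \sum_(i < d) A i + A d.
  by rewrite [X in _ + X]addrAC addrCA e addFF2.
by rewrite -[RHS](@big_ord_recr _ _ _ d (fun i => A i)) big_ord_recl.
Qed.

Fact symbol_subproof d (u : 'I_d -> F) : symbol_cochain u \in @cocycle F K d.
Proof.
by apply/asboolP; split; [apply: symbol_continuous | apply: symbol_cocycle].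
Qed.

Definition symbol d (u : 'I_d -> F) : H K d :=
  \pi_(H K d) (Cocycle (symbol_subproof u)).

End Symbols.

Section Restriction.
Variables (F F' : fieldType) (rho : {rmorphism F -> F'}).
Variables (K : sepClosure F) (K' : sepClosure F') (j : {rmorphism K -> K'}).
Hypothesis jE : forall a, j (sepclosure_in K a) = sepclosure_in K' (rho a).

Lemma gal_stable (s : gal K') (x : K) : exists y, j y = s (j x).
Proof.
have [p p_sep px] := sepclosure_separable x.
pose q := map_poly (sepclosure_in K) p.
have q_sep : separable_poly q by rewrite separable_map.
have split_q : forall (n : nat) (r : {poly K}), (size r <= n.+1)%N ->
    separable_poly r -> forall z : K', root (map_poly j r) z ->
    exists y, j y = z.
  elim=> [|n IH] r rn r_sep z rz.
    have r0 := separable_poly_neq0 r_sep.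
    have /size_poly1P[c c0 rE] : size r == 1%N.
      by rewrite eqn_leq rn size_poly_gt0.
    by move: rz; rewrite rE map_polyC rootC fmorph_eq0 (negPf c0).
  have r0 := separable_poly_neq0 r_sep.
  have [r1|r1] := leqP (size r) 1%N.
    by apply: (IH r) => //; apply: leq_trans r1 _.
  have [y ry] := sepclosure_closed r_sep r1.
  have /factor_theorem[t rE] := ry.
  move: rz; rewrite rE rmorphM /= rootM => /orP[tz|].
    apply: (IH t) => //.
      rewrite -ltnS; apply: leq_trans rn.
      rewrite rE size_Mmonic ?monicXsubC ?size_XsubC ?addn2 //=.
      by apply: contraNneq r0 => t0; rewrite rE t0 mul0r.
    by move: r_sep; rewrite rE separable_mul => /and3P[].
  rewrite map_polyXsubC root_XsubC => /eqP ->; by exists y.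
apply: (split_q (size q) q) => //.
have -> : map_poly j q = map_poly (sepclosure_in K' \o rho) p.
  by rewrite -map_poly_comp; apply: eq_map_poly => a /=; rewrite jE.
have -> : map_poly (sepclosure_in K' \o rho) p =
    map_poly s (map_poly j q).
  rewrite -!map_poly_comp; apply: eq_map_poly => a /=.
  by rewrite jE gal_in.
by rewrite !fmorph_root.
Qed.

Definition gal_res_fun (s : gal K') (x : K) : K := sval (cid (gal_stable s x)).

Lemma gal_res_funE (s : gal K') x : j (gal_res_fun s x) = s (j x).
Proof. exact: (svalP (cid (gal_stable s x))). Qed.

Fact gal_res_subproof (s : gal K') : gal_prop (gal_res_fun s).
Proof.
have jI := fmorph_inj j; split => [x y|x y||a].
- by apply: jI; rewrite rmorphD /= !gal_res_funE !rmorphD.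
- by apply: jI; rewrite rmorphM /= !gal_res_funE !rmorphM.
- exists (gal_res_fun s^-1%g) => x; apply: jI; rewrite !gal_res_funE -galM.
    by rewrite mulVg.
  by rewrite mulgV.
- by apply: jI; rewrite gal_res_funE !jE gal_in.
Qed.

(* The continuous homomorphism from gal K' to gal K induced by j. *)
Definition gal_res (s : gal K') : gal K := mk_gal (gal_res_subproof s).

Lemma gal_resE (s : gal K') x : j (gal_res s x) = s (j x).
Proof. exact: gal_res_funE. Qed.

Lemma gal_resM (s t : gal K') : gal_res (s * t)%g = (gal_res s * gal_res t)%g.
Proof.
apply: gal_ext => x; apply: (fmorph_inj j).
by rewrite galM !gal_resE galM.
Qed.

Definition cochain_res d (f : cochain K d) : cochain K' d :=
  fun s => f (gal_res \o s).

Lemma cochain_res_continuous d (f : cochain K d) :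
  continuous_cochain f -> continuous_cochain (cochain_res f).
Proof.
move=> cf s; have [S hS] := cf (gal_res \o s); exists [seq j x | x <- S].
move=> t ts; apply: hS => i x xS /=; apply: (fmorph_inj j).
by rewrite !gal_resE ts //; apply: map_f.
Qed.

Lemma cochain_res_dcochain d (f : cochain K d) :
  dcochain (cochain_res f) = cochain_res (dcochain f).
Proof.
apply/funext => s; rewrite /dcochain /cochain_res; apply: eq_bigr => i _.
congr (f _); apply/funext => k; rewrite /face /=.
by case: ifP => // _; case: ifP => // _; rewrite gal_resM.
Qed.

Fact cocycle_res_subproof d (f : Z K d) :
  cochain_res f \in @cocycle F' K' d.
Proof.
case: f => f /= /asboolP[cf df]; apply/asboolP; split.
  exact: cochain_res_continuous.
by rewrite cochain_res_dcochain df.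
Qed.

Definition cocycle_res d (f : Z K d) : Z K' d :=
  Cocycle (cocycle_res_subproof f).

Fact cocycle_res_zmod_morphism d : zmod_morphism (@cocycle_res d).
Proof. by move=> f g; apply: val_inj. Qed.
HB.instance Definition _ d := GRing.isZmodMorphism.Build (Z K d) (Z K' d)
  (@cocycle_res d) (@cocycle_res_zmod_morphism d).

Lemma cocycle_res_coboundary d (f : Z K d) :
  f \in @coboundary F K d -> cocycle_res f \in @coboundary F' K' d.
Proof.
case: d f => [|d] f.
  by move/eqP ->; rewrite raddf0; apply/eqP.
move=> /asboolP[g cg fg]; apply/asboolP; exists (cochain_res g).
  exact: cochain_res_continuous.
by rewrite cochain_res_dcochain -fg.
Qed.

Definition res d (c : H K d) : H K' d := \pi_(H K' d) (cocycle_res (repr c)).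

Lemma res_pi d (f : Z K d) :
  res (\pi_(H K d) f) = \pi_(H K' d) (cocycle_res f).
Proof.
apply/eqP; rewrite /res -Quotient.idealrBE -raddfB /=.
by apply: cocycle_res_coboundary; rewrite Quotient.idealrBE reprK.
Qed.

Fact res_zmod_morphism d : zmod_morphism (@res d).
Proof.
move=> c1 c2; rewrite -[c1]reprK -[c2]reprK -raddfB !res_pi.
by rewrite !raddfB.
Qed.
HB.instance Definition _ d := GRing.isZmodMorphism.Build (H K d) (H K' d)
  (@res d) (@res_zmod_morphism d).

End Restriction.

(* Normalized (surjective) discrete valuations; the value at 0, which should be
   +oo, is irrelevant. *)
Record discrete_valuation (F : fieldType) := DiscreteValuation {
  dval :> F -> int;
  dvalM : forall x y, x != 0 -> y != 0 -> dval (x * y) = dval x + dval y;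
  dvalD : forall x y, x != 0 -> y != 0 -> x + y != 0 ->
    Num.min (dval x) (dval y) <= dval (x + y);
  dval_surj : exists2 x, x != 0 & dval x = 1
}.

Arguments dvalM {F} d {x y}.
Arguments dvalD {F} d {x y}.

Section Valuation.
Variables (F : fieldType) (v : discrete_valuation F).

Definition valring_pred : {pred F} := fun x => (x == 0) || (0 <= v x).

Lemma dval1 : v 1 = 0.
Proof.
by apply: (addIr (v 1)); rewrite add0r -dvalM ?oner_eq0 ?mulr1.
Qed.

Lemma dvalN1 : v (-1) = 0.
Proof.
have N1 : -1 != 0 :> F by rewrite oppr_eq0 oner_eq0.
have : v (-1) + v (-1) = 0 by rewrite -dvalM // mulrNN mulr1 dval1.
by move/eqP; rewrite -mulr2n mulrn_eq0 => /eqP.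
Qed.

Lemma dvalN x : x != 0 -> v (- x) = v x.
Proof. by move=> x0; rewrite -mulN1r dvalM ?dvalN1 ?add0r // oppr_eq0 oner_eq0. Qed.

Lemma dvalV x : x != 0 -> v x^-1 = - v x.
Proof.
move=> x0; apply: (addrI (v x)).
by rewrite -dvalM ?invr_eq0 // mulfV // dval1 subrr.
Qed.

Lemma dvalB_ge (m : int) (x y : F) : (x == 0) || (m <= v x) ->
  (y == 0) || (m <= v y) -> (x - y == 0) || (m <= v (x - y)).
Proof.
have [->|x0] := eqVneq x 0; have [->|y0] := eqVneq y 0; rewrite /= => mx my.
- by rewrite subrr eqxx.
- by rewrite sub0r dvalN // my orbT.
- by rewrite subr0 mx orbT.
have [//|xy0 /=] := eqVneq (x - y) 0.
have Ny0 : - y != 0 by rewrite oppr_eq0.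
by apply: (le_trans _ (dvalD v x0 Ny0 xy0)); rewrite le_min mx dvalN.
Qed.

Fact valring_subring_closed : subring_closed valring_pred.
Proof.
split; first by rewrite unfold_in dval1 lexx orbT.
- by move=> x y; apply: dvalB_ge.
- move=> x y; rewrite !unfold_in.
  have [->|x0] := eqVneq x 0; first by rewrite mul0r eqxx.
  have [->|y0] := eqVneq y 0; first by rewrite mulr0 eqxx.
  by move=> /= hx hy; rewrite dvalM // addr_ge0 ?orbT.
Qed.
HB.instance Definition _ :=
  GRing.isSubringClosed.Build F valring_pred valring_subring_closed.

Record valring := ValRing { valring_val :> F; _ : valring_val \in valring_pred }.
HB.instance Definition _ := [isSub for valring_val].
HB.instance Definition _ := [Choice of valring by <:].
HB.instance Definition _ := [SubChoice_isSubComNzRing of valring by <:].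

Definition valring_max : {pred valring} :=
  fun x => (val x == 0) || (1 <= v (val x)).

Fact valring_max_idealr : idealr_closed valring_max.
Proof.
split.
- by rewrite unfold_in rmorph0 eqxx.
- by rewrite unfold_in rmorph1 oner_eq0 dval1.
move=> [a ha] [x hx'] [y hy']; rewrite !unfold_in rmorphD rmorphM /= => hx hy.
rewrite -[y]opprK; apply: dvalB_ge.
  move: ha hx; rewrite unfold_in.
  have [->|a0] := eqVneq a 0; first by rewrite mul0r eqxx.
  have [->|x0] := eqVneq x 0; first by rewrite mulr0 eqxx.
  by rewrite /= => ha hx; rewrite dvalM // -[1]add0r lerD ?orbT.
by rewrite oppr_eq0; move: hy; have [//|y0] := eqVneq y 0; rewrite /= dvalN.
Qed.
HB.instance Definition _ :=
  isIdealr.Build valring valring_max valring_max_idealr.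

Definition residue_field : Type := {ideal_quot valring_max}.
HB.instance Definition _ := GRing.ComNzRing.copy residue_field {ideal_quot valring_max}.

Definition residue (x : valring) : residue_field :=
  \pi_({ideal_quot valring_max}) x.

Fact residue_zmod_morphism : zmod_morphism residue.
Proof. by move=> x y; rewrite /residue rmorphB. Qed.
HB.instance Definition _ :=
  GRing.isZmodMorphism.Build valring residue_field residue residue_zmod_morphism.
Fact residue_monoid_morphism : monoid_morphism residue.
Proof. by split=> [|x y]; rewrite /residue ?rmorph1 ?rmorphM. Qed.
HB.instance Definition _ :=
  GRing.isMonoidMorphism.Build valring residue_field residue
    residue_monoid_morphism.

Lemma residue_surj (z : residue_field) : exists x, residue x = z.
Proof. by exists (repr z); exact: reprK. Qed.

Lemma residue_eq0 (x : valring) : (residue x == 0) = (x \in valring_max).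
Proof.
rewrite -(rmorph0 residue) -[x in RHS]subr0.
by rewrite (Quotient.idealrBE valring_max).
Qed.

Fact valring_inv_subproof (x : valring) :
  x \notin valring_max -> (val x)^-1 \in valring_pred.
Proof.
rewrite unfold_in negb_or -ltNge => /andP[x0 vx].
have := valP x; rewrite !unfold_in (negPf x0) invr_eq0 (negPf x0) /= => hx.
by rewrite dvalV // oppr_ge0 -ltzD1 add0r.
Qed.

Definition residue_inv (z : residue_field) : residue_field :=
  if z == 0 then 0 else residue (insubd (0 : valring) (val (repr z))^-1).

Fact residue_mulVf (z : residue_field) : z != 0 -> residue_inv z * z = 1.
Proof.
move=> z0; rewrite /residue_inv (negPf z0).
have zE : residue (repr z) = z by exact: reprK.
have zm : repr z \notin valring_max by rewrite -residue_eq0 zE.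
rewrite -[X in _ * X]zE -rmorphM -(rmorph1 residue); congr residue.
apply: val_inj; rewrite rmorphM rmorph1 /= insubdK ?valring_inv_subproof //.
by rewrite mulVf //; move: zm; rewrite unfold_in negb_or => /andP[].
Qed.

Fact residue_invr0 : residue_inv 0 = 0.
Proof. by rewrite /residue_inv eqxx. Qed.

HB.instance Definition _ :=
  GRing.ComNzRing_isField.Build residue_field residue_mulVf residue_invr0.

Definition nondyadic : Prop := 2%N \notin [pchar residue_field].

End Valuation.

(* The conditions characterizing the residue homomorphism of a nondyadic v on
   H^{d+1}; units are given as elements of the valuation ring with nonzero
   residue, and [ucons p u] is (p, u_0, ..., u_{d-1}). *)
Definition ucons T d (p : T) (u : 'I_d -> T) : 'I_d.+1 -> T :=
  fun i => oapp u p (unlift ord0 i).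

Definition is_residue_hom (F : fieldType) (K : sepClosure F)
    (v : discrete_valuation F) (k : sepClosure (residue_field v)) (d : nat)
    (dv : {additive H K d.+1 -> H k d}) : Prop :=
  (forall u : 'I_d.+1 -> valring v,
     (forall i, residue (u i) != 0) ->
     dv (symbol K (fun i => val (u i))) = 0) /\
  (forall (p : F) (u : 'I_d -> valring v),
     p != 0 -> v p = 1 -> (forall i, residue (u i) != 0) ->
     dv (symbol K (ucons p (fun i => val (u i)))) =
       symbol k (fun i => residue (u i))).

(* For v nondyadic there is exactly one such dv: the residue homomorphism. *)
Definition unramified_at (F : fieldType) (K : sepClosure F)
    (v : discrete_valuation F) (d : nat) (c : H K d.+1) : Prop :=
  forall (k : sepClosure (residue_field v)) (dv : {additive H K d.+1 -> H k d}),
    is_residue_hom dv -> dv c = 0.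

(* P is the set of nonnegative elements. *)
Definition field_ordering (F : fieldType) (P : set F) : Prop :=
  [/\ forall x y, P x -> P y -> P (x + y),
      forall x y, P x -> P y -> P (x * y),
      forall x, P x \/ P (- x)
    & forall x, P x -> P (- x) -> x = 0].

Definition is_real_closure (F : fieldType) (P : set F)
    (R : rcfType) (rho : {rmorphism F -> R}) : Prop :=
  (forall x : R, algebraicOver rho x) /\ (forall x : F, P x <-> 0 <= rho x).

Definition killed_by_real_closures (F : fieldType) (K : sepClosure F)
    (d : nat) (c : H K d) : Prop :=
  forall (P : set F) (R : rcfType) (rho : {rmorphism F -> R}),
    field_ordering P -> is_real_closure P rho ->
  forall (L : sepClosure R) (j : {rmorphism K -> L})
    (jE : forall a, j (sepclosure_in K a) = sepclosure_in L (rho a)),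
    res jE c = 0.

(* [Hu K d] is the subgroup H^{d+1}_u(F) of H^{d+1}(F), for d > 0. *)
Definition Hu (F : fieldType) (K : sepClosure F) (d : nat) : set (H K d.+1) :=
  [set c | (forall v : discrete_valuation F, nondyadic v -> unramified_at v c)
           /\ killed_by_real_closures c].

(* Main.v *)
From HB Require Import structures.
Require Import Defs.
From mathcomp Require Import all_boot all_order all_algebra all_field.
From mathcomp Require Import boolp classical_sets functions.
From mathcomp Require Import ring.

Set Implicit Arguments.
Unset Strict Implicit.
Unset Printing Implicit Defensive.

Import Order.TTheory GRing.Theory Num.Theory.

Local Open Scope ring_scope.
Local Open Scope quotient_scope.
Local Open Scope classical_set_scope.

(** The common class c = (a_i) (b_i) in H^2(F) is unramified everywhere and
dies in every real closure; hence it vanishes, and a quaternion algebra whose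
class vanishes is split.

At a nondyadic valuation v with uniformizer p, every nonzero element is, up to
squares, p^m u with m a bit and u a unit, and the residue of
(p^m u) (p^n w) is m (w) + n (u) + m n e in H^1 of the residue field, where e is
the residue of (p) (p).  The bits and unit classes of the a_i and b_j thus satisfy
a system of equations in an abelian group: the six off-diagonal residues are 0,
the three diagonal ones are one element t.  A finite argument ([tame_form_eq0])
gives t = 0; it works with three indices but would fail with two.

Over a real closure, a symbol with a nonnegative entry vanishes.  So if c
survived, all a_i and b_i would be negative, whereas (a_0, b_2) being split
makes b_2 a norm x^2 - a_0 y^2, which is nonnegative.

What remains is the dictionary between quaternion algebras and symbols, where the
pivot is the property that b is a norm from F(sqrt a) ([is_norm]):
- it is equivalent to the splitting of (a, b): [split_is_norm] (zero divisors),
  [is_norm_split] (explicit 2 x 2 matrices);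
- it is equivalent to (a) (b) = 0: [sym_of_norm_eq0] writes down a cochain from
  a square root of x + y sqrt a, and [sym_eq0_is_norm] reads a cochain backwards,
  with Hilbert 90 for characters of order 2 ([quadratic_hilbert90]);
- isomorphic algebras have equal symbols, because two presentations of one
  algebra share a slot after a change of generators ([isom_sym]).

The passage from cochains back to F needs Galois theory of the possibly infinite
extension K / F: an element of K fixed by all automorphisms lies in F
([gal_fixed]), and an automorphism fixing all that a group N fixes agrees with
some element of N on any finite set ([gal_density]).  The first requires
automorphisms to exist; they come from Zorn's lemma applied to subrings of
K x K that are graphs of partial isomorphisms ([partial_iso_gal]). *)

(** * Symbols in degree two *)

Section Symbols.
Variables (F : fieldType) (K : sepClosure F).
Local Notation iota := (sepclosure_in K).
Local Notation G := (Defs.gal K).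
Implicit Types (s t : G) (a b u : F).

Lemma cohomology_addxx d (c : H K d) : c + c = 0.
Proof.
rewrite -[c]reprK -raddfD /=; suff -> : repr c + repr c = 0 by rewrite raddf0.
by apply/val_inj/funext => s /=; apply: addFF2.
Qed.

Lemma F2P (x : 'F_2) : x = 0 \/ x = 1.
Proof. by case: x => [[|[|x]] hx] //; [left | right]; apply: val_inj. Qed.

Definition sym a b : H K 2 := symbol K (ucons a (fun=> b)).

Lemma ucons0 T (x y : T) : ucons x (fun=> y) (@ord0 1) = x.
Proof. by rewrite /ucons unlift_none. Qed.

Lemma ucons1 T (x y : T) : ucons x (fun=> y) (@ord_max 1) = y.
Proof.
by rewrite (_ : ord_max = lift ord0 ord0) ?/ucons ?liftK //; apply: val_inj.
Qed.

Lemma symbol2E (u : 'I_2 -> F) : symbol K u = sym (u ord0) (u ord_max).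
Proof.
congr symbol; apply/funext => i; rewrite /ucons.
case: unliftP => [j|] -> //=; congr u; apply: val_inj.
by case: j => [[]].
Qed.

Lemma cochain_symE a b (s : 'I_2 -> G) :
  symbol_cochain (ucons a (fun=> b)) s
  = kummer a (s ord0) * kummer b (s ord_max).
Proof.
rewrite /symbol_cochain !big_ord_recl big_ord0 mulr1 /ucons unlift_none liftK /=.
by congr (_ * kummer _ (s _)); apply: val_inj.
Qed.

(** Continuity of a 1-cochain, written without the index type 'I_1. *)
Definition locally_constant (g : G -> 'F_2) : Prop :=
  forall s, exists S : seq K, forall t, {in S, t =1 s} -> g t = g s.

Lemma dcochain1E (g : cochain K 1) (s : 'I_2 -> G) :
  dcochain g s = g (fun=> s ord0) + g (fun=> s ord_max)
                 + g (fun=> (s ord0 * s ord_max)%g).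
Proof.
rewrite /dcochain !big_ord_recl big_ord0 addr0.
have E (i j : 'I_2) : i = j :> nat -> s i = s j by move=> /val_inj->.
have -> : face (@ord0 2) s = fun=> s ord_max.
  by apply/funext => -[[|k] hk] //; rewrite /face /=; exact: E.
have -> : face (lift (@ord0 2) (@ord0 1)) s = fun=> (s ord0 * s ord_max)%g.
  by apply/funext => -[[|k] hk] //; rewrite /face /=; apply: f_equal2; exact: E.
have -> : face (lift (@ord0 2) (lift (@ord0 1) (@ord0 0))) s = fun=> s ord0.
  by apply/funext => -[[|k] hk] //; rewrite /face /=; exact: E.
by rewrite [X in _ + X]addrC addrCA !addrA.
Qed.

Lemma H2_eq0P (f : Z K 2) :
  \pi_(H K 2) f = 0 <-> exists2 g : G -> 'F_2, locally_constant g &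
    forall s : 'I_2 -> G,
      cocycle_fun f s = g (s ord0) + g (s ord_max) + g (s ord0 * s ord_max)%g.
Proof.
have -> : \pi_(H K 2) f = 0 <-> f \in @coboundary F K 2.
  rewrite -[X in X \in _]subr0 Quotient.idealrBE raddf0.
  by split => /eqP.
split.
  move=> /asboolP[g cg /= e]; exists (fun s => g (fun=> s)).
    move=> s; have [S hS] := cg (fun=> s); exists S => t ts.
    by apply: hS => i; apply: ts.
  by move=> s; rewrite e dcochain1E.
move=> [g cg e]; apply/asboolP; exists (fun s : 'I_1 -> G => g (s ord0)).
  move=> s; have [S hS] := cg (s ord0); exists S => t ts.
  by apply: hS; apply: ts.
by apply/funext => s /=; rewrite dcochain1E e.
Qed.

Lemma sym_eq0P a b :
  sym a b = 0 <-> exists2 g : G -> 'F_2, locally_constant g &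
    forall s t, kummer a s * kummer b t = g s + g t + g (s * t)%g.
Proof.
rewrite /sym /symbol H2_eq0P; split => -[g cg e]; exists g => //.
  move=> s t; have := e (ucons s (fun=> t)); rewrite /= cochain_symE.
  by rewrite ucons0 ucons1.
by move=> s /=; rewrite cochain_symE e.
Qed.

Lemma eq_of_add_eq0 (V : zmodType) (H2 : forall x : V, x + x = 0) (x y : V) :
  x + y = 0 -> x = y.
Proof. by move=> /(congr1 (+%R^~ y)); rewrite -addrA H2 addr0 add0r. Qed.

Lemma kummer_locally_constant a : locally_constant (kummer a).
Proof.
move=> s; have [S hS] := @symbol_continuous F K 1 (fun=> a) (fun=> s).
exists S => t ts; have := hS (fun=> t) (fun=> ts).
by rewrite /symbol_cochain !big_ord1.
Qed.

(** The pointwise product of the two characters is a 1-cochain whose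
coboundary is the difference of the two cup products. *)
Lemma symC a b : sym a b = sym b a.
Proof.
apply: (eq_of_add_eq0 (@cohomology_addxx 2)).
rewrite /sym /symbol -raddfD; apply/H2_eq0P.
exists (fun s => kummer a s * kummer b s).
  move=> s; have [S hS] := kummer_locally_constant a s.
  have [T hT] := kummer_locally_constant b s.
  exists (S ++ T) => t ts; congr (_ * _); [apply: hS | apply: hT] => x xS;
    by apply: ts; rewrite mem_cat xS ?orbT.
move=> s; rewrite -[LHS]/(symbol_cochain _ s + symbol_cochain _ s).
rewrite !cochain_symE !kummerM.
move: (kummer a (s ord0)) (kummer a (s ord_max)) => x y.
move: (kummer b (s ord0)) (kummer b (s ord_max)) => z w.
transitivity ((x * z + x * z) + (y * w + y * w) + (x * w + z * y)); last by ring.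
by rewrite !addFF2 !add0r.
Qed.

Hypothesis char2 : 2%N \notin [pchar F].

Lemma two_neq0 : 2%:R != 0 :> F.
Proof. by apply: contra char2 => h; rewrite inE /=. Qed.

Lemma two_neq0K : 2%:R != 0 :> K.
Proof. by rewrite -(rmorph_nat iota) fmorph_eq0 two_neq0. Qed.

Lemma sqrt_exists (x : K) : exists y : K, y ^+ 2 = x.
Proof.
have [->|x0] := eqVneq x 0; first by exists 0; rewrite expr0n.
have sz : size ('X^2 - x%:P) = 3 by rewrite size_XnsubC.
have sep : separable_poly ('X^2 - x%:P); last first.
  have [|y] := sepclosure_closed sep; first by rewrite sz.
  by rewrite rootE !hornerE subr_eq0 => /eqP; exists y.
rewrite unlock derivB derivC subr0 derivXn /=.
rewrite -scaler_nat coprimepZr ?two_neq0K // expr1.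
by rewrite coprimepX rootE !hornerE expr0n sub0r oppr_eq0.
Qed.

Definition sqrt_in (a : F) : K := sval (cid (sqrt_exists (iota a))).
Lemma sqrt_inE a : sqrt_in a ^+ 2 = iota a.
Proof. exact: svalP (cid (sqrt_exists (iota a))). Qed.

Lemma sqrt_in_neq0 a : a != 0 -> sqrt_in a != 0.
Proof.
apply: contraNneq => h; have := sqrt_inE a; rewrite h expr0n => /esym/eqP.
by rewrite fmorph_eq0.
Qed.

(** Working with signs in K turns statements about values in 'F_2 into
identities between elements of K; [signF2_inj] brings them back. *)
Lemma gal_sign (s : G) (x : K) (u : F) : x ^+ 2 = iota u ->
  s x = (-1) ^+ (kummer u s) * x.
Proof.
move=> xu; rewrite (kummerE s xu).
have : s x ^+ 2 = x ^+ 2 by rewrite -rmorphXn /= xu gal_in.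
move/eqP; rewrite eqf_sqr => /orP[] /eqP ->.
  by rewrite eqxx mul1r.
have [e|_] := eqVneq (- x) x; last by rewrite mulN1r.
by rewrite mul1r.
Qed.

Lemma signF2_1 : (-1) ^+ (1%R : 'F_2) = -1 :> K.
Proof. by rewrite -[RHS]expr1. Qed.

Lemma signF2_0 : (-1) ^+ (0%R : 'F_2) = 1 :> K.
Proof. by rewrite -[RHS](expr0 (-1)). Qed.

Lemma signF2D (x y : 'F_2) : (-1) ^+ (x + y)%R = (-1) ^+ x * (-1) ^+ y :> K.
Proof.
have [->|->] := F2P x; have [->|->] := F2P y;
  by rewrite ?addFF2 ?addr0 ?add0r ?signF2_1 ?signF2_0 ?mulrNN ?mulr1 ?mul1r.
Qed.

Lemma N1_neq1 : -1 != 1 :> K.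
Proof. by rewrite eq_sym -addr_eq0; exact: two_neq0K. Qed.

Lemma signF2_inj (x y : 'F_2) : (-1) ^+ x = (-1) ^+ y :> K -> x = y.
Proof.
have h := N1_neq1; have h' := h; rewrite eq_sym in h'.
have [->|->] := F2P x; have [->|->] := F2P y; rewrite ?signF2_1 ?signF2_0 //.
  by move/eqP; rewrite (negPf h').
by move/eqP; rewrite (negPf h).
Qed.

Lemma kummerMu (a b : F) s : a != 0 -> b != 0 ->
  kummer (a * b) s = kummer a s + kummer b s.
Proof.
move=> a0 b0; apply: signF2_inj; rewrite signF2D.
have ab : (sqrt_in a * sqrt_in b) ^+ 2 = iota (a * b).
  by rewrite exprMn !sqrt_inE rmorphM.
have ab0 : sqrt_in a * sqrt_in b != 0 by rewrite mulf_neq0 ?sqrt_in_neq0.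
apply: (mulIf ab0); rewrite -(gal_sign _ ab) rmorphM /=.
by rewrite !(gal_sign s (sqrt_inE _)); ring.
Qed.

Lemma symMl a a' b : a != 0 -> a' != 0 -> sym (a * a') b = sym a b + sym a' b.
Proof.
move=> a0 a'0; rewrite /sym /symbol -raddfD; congr \pi; apply/val_inj/funext => s.
rewrite -[RHS]/(symbol_cochain _ s + symbol_cochain _ s) /= !cochain_symE.
by rewrite kummerMu // mulrDl.
Qed.

Lemma symMr a b b' : b != 0 -> b' != 0 -> sym a (b * b') = sym a b + sym a b'.
Proof. by move=> b0 b'0; rewrite symC symMl // !(symC a). Qed.

(** Let z = x + y sqrt a, z' its conjugate, d a square root of z and
d' = sqrt b / d, so that d'^2 = z'.  An automorphism s sends d to d or d' up to
a sign, according to its action on sqrt a; the exponent g s of this sign is a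
cochain with coboundary (b) (a). *)
Lemma sym_of_norm_eq0 a b x y : b != 0 -> b = x ^+ 2 - a * y ^+ 2 -> sym a b = 0.
Proof.
move=> b0 e.
pose al := sqrt_in a.
have alE : al ^+ 2 = iota a := sqrt_inE a.
pose z := iota x + al * iota y; pose z' := iota x - al * iota y.
have zz' : z * z' = iota b.
  by rewrite e rmorphB rmorphXn rmorphM rmorphXn -alE /z /z'; ring.
have ib0 : iota b != 0 by rewrite fmorph_eq0.
have z0 : z != 0 by apply: contraNneq ib0 => h; rewrite -zz' h mul0r.
have [de deE] := sqrt_exists z.
have de0 : de != 0.
  by apply: contraNneq z0 => h; rewrite -deE h expr0n.
pose be := sqrt_in b; have beE : be ^+ 2 = iota b := sqrt_inE b.
have be0 : be != 0 := sqrt_in_neq0 b0.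
pose d (x : 'F_2) := if x == 0 then de else be / de.
have d0 i : d i != 0 by rewrite /d; case: ifP => // _; rewrite mulf_neq0 ?invr_eq0.
have gP s : exists i : 'F_2, s de = (-1) ^+ i * d (kummer a s).
  have : (s de) ^+ 2 = (d (kummer a s)) ^+ 2.
    rewrite -rmorphXn deE /d /z rmorphD rmorphM /= !gal_in (gal_sign s alE).
    case: eqP => [->|h].
      by rewrite mul1r deE.
    have [//|->] := F2P (kummer a s).
    rewrite expr_div_n beE deE -zz' [z * z']mulrC mulfK // /z' /=; ring.
  move/eqP; rewrite eqf_sqr => /orP[] /eqP ->.
    by exists 0; rewrite mul1r.
  by exists 1; rewrite mulN1r.
pose g s := sval (cid (gP s)).
have gE s : s de = (-1) ^+ (g s) * d (kummer a s) := svalP (cid (gP s)).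
rewrite symC; apply/sym_eq0P; exists g.
  move=> s; have [S hS] := kummer_locally_constant a s; exists (de :: S) => t ts.
  apply: signF2_inj; apply: (mulIf (d0 (kummer a s))).
  rewrite -gE -[in LHS](hS t); last by move=> u uS; apply: ts; rewrite inE uS orbT.
  by rewrite -gE ts // inE eqxx.
move=> s t.
have dE i : s (d i) = (-1) ^+ (g s + kummer b s * i)%R * d (kummer a s + i).
  have [->|->] := F2P i.
    by rewrite mulr0 !addr0 gE.
  rewrite mulr1 {1}/d /= fmorph_div /= (gal_sign s beE) gE signF2D.
  have [->|->] := F2P (kummer a s); rewrite ?addr0 ?add0r ?addFF2 /d /=;
  have [->|->] := F2P (g s); have [->|->] := F2P (kummer b s);
   rewrite ?signF2_0 ?signF2_1; field; rewrite ?de0 ?be0 ?oppr_eq0 ?oner_eq0 //.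
have -> : g (s * t)%g = g t + (g s + kummer b s * kummer a t).
  apply: signF2_inj; apply: (mulIf (d0 (kummer a (s * t)%g))).
  rewrite -gE Defs.galM gE (signF2D (g t)) (kummerM a).
  rewrite rmorphM rmorphXn rmorphN1 [LHS]/= dE.
  by rewrite mulrA.
transitivity (g s + g s + (g t + g t) + kummer b s * kummer a t); last by ring.
by rewrite !addFF2 !add0r.
Qed.
End Symbols.

(** * Quaternion algebras and norms *)

Section Quaternions.
Variable F : fieldType.
Implicit Types a b x y : F.

Lemma qcM a b (q r : quat a b) :
  ((qc (q * r) 0 = qc q 0 * qc r 0 + a * (qc q 1 * qc r 1)
      + b * (qc q 2 * qc r 2) - a * b * (qc q 3 * qc r 3))
   * (qc (q * r) 1 = qc q 0 * qc r 1 + qc q 1 * qc r 0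
      - b * (qc q 2 * qc r 3) + b * (qc q 3 * qc r 2)))
  * ((qc (q * r) 2 = qc q 0 * qc r 2 + qc q 2 * qc r 0
      + a * (qc q 1 * qc r 3) - a * (qc q 3 * qc r 1))
   * (qc (q * r) 3 = qc q 0 * qc r 3 + qc q 3 * qc r 0
      + qc q 1 * qc r 2 - qc q 2 * qc r 1)).
Proof. by rewrite /GRing.mul /= /quat_mul !qc_mk. Qed.

Lemma qcN a b (q : quat a b) i : qc (- q) i = - qc q i.
Proof. by rewrite /qc mxE. Qed.

Lemma qc1 a b :
  ((qc (1 : quat a b) 0 = 1) * (qc (1 : quat a b) 1 = 0))
  * ((qc (1 : quat a b) 2 = 0) * (qc (1 : quat a b) 3 = 0)).
Proof. by do !split; rewrite [X in qc X]/GRing.one /= /quat_one qc_mk. Qed.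

Lemma qcA a b x :
  ((qc (x%:A : quat a b) 0 = x) * (qc (x%:A : quat a b) 1 = 0))
  * ((qc (x%:A : quat a b) 2 = 0) * (qc (x%:A : quat a b) 3 = 0)).
Proof. by rewrite !qcZ !qc1 mulr1 !mulr0. Qed.

(** b is a norm from F(sqrt a); when a is a square, from F x F instead. *)
Definition is_norm a b := exists xy : F * F, b = xy.1 ^+ 2 - a * xy.2 ^+ 2.

Definition has_zero_divisors (A : nzRingType) :=
  exists2 q : A, q != 0 & exists2 r : A, r != 0 & q * r = 0.

Hypothesis two0 : 2%:R != 0 :> F.

(** If a is a square then x^2 - a y^2 is a hyperbolic plane, which represents
every b. *)
Lemma square_is_norm a b u v : a != 0 -> v != 0 -> u ^+ 2 = a * v ^+ 2 ->
  is_norm a b.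
Proof.
move=> a0 v0 e.
have u0 : u != 0.
  by rewrite -sqrf_eq0 e mulf_neq0 ?sqrf_eq0.
exists ((b + 1) / 2%:R, v * (b - 1) / (2%:R * u)) => /=.
have -> : a = u ^+ 2 / v ^+ 2 by rewrite e mulfK ?sqrf_eq0.
by field; rewrite v0 u0 two0.
Qed.

(** A zero divisor q has reduced norm 0, that is
x0^2 - a x1^2 = b (x2^2 - a x3^2) with the x_i not all 0.  Norms from F(sqrt a)
are closed under quotients, so b is a norm if the right-hand factor is nonzero;
otherwise a is a square. *)
Lemma zero_div_is_norm a b : a != 0 -> b != 0 -> has_zero_divisors (quat a b) ->
  is_norm a b.
Proof.
move=> a0 b0 [q q0 [r r0 qr]].
have nq0 : qc q 0 ^+ 2 - a * qc q 1 ^+ 2 - b * (qc q 2 ^+ 2 - a * qc q 3 ^+ 2) = 0.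
  apply: contraNeq r0 => n0; rewrite -(inj_eq (scalerI n0)) scaler0.
  (* the conjugate of q: multiplying by it turns q r = 0 into n(q) r = 0 *)
  pose q' : quat a b := mkquat a b (qc q 0) (- qc q 1) (- qc q 2) (- qc q 3).
  have : q' * (q * r) = 0 by rewrite qr mulr0.
  rewrite mulrA => <-; rewrite -mulr_algl; apply/eqP; congr (_ * _).
  by apply: quatP; rewrite !qcM !qcA !qc_mk; ring.
have pair0 u v : u ^+ 2 = a * v ^+ 2 -> (u, v) != (0, 0) -> is_norm a b.
  move=> e uv; apply: (@square_is_norm a b u v) => //.
  apply: contraNneq uv => v0; move: e; rewrite v0 expr0n mulr0.
  by move=> /eqP; rewrite sqrf_eq0 => /eqP->.
have [w0|w0] := eqVneq (qc q 2 ^+ 2 - a * qc q 3 ^+ 2) 0; last first.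
  exists ((qc q 0 * qc q 2 + a * qc q 1 * qc q 3) / (qc q 2 ^+ 2 - a * qc q 3 ^+ 2),
          (qc q 0 * qc q 3 + qc q 1 * qc q 2) / (qc q 2 ^+ 2 - a * qc q 3 ^+ 2)).
  apply: (mulIf w0); rewrite -(subr0_eq nq0) /=.
  by field.
have [h|h] := eqVneq (qc q 2, qc q 3) (0, 0).
  apply: (pair0 (qc q 0) (qc q 1)).
    by apply: subr0_eq; rewrite -nq0 w0 mulr0 subr0.
  case: h => q2 q3; apply: contraNneq q0 => -[q0 q1].
  by apply/eqP/quatP; rewrite qc0.
by apply: (pair0 _ _ _ h); apply/eqP; rewrite -subr_eq0 w0.
Qed.

Section Matrix.
Variables a x y : F.
Local Notation b := (x ^+ 2 - a * y ^+ 2).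
(** The representation sending i to ((0, a), (1, 0)) and j to
((x, - a y), (y, - x)); these anticommute and the square of the latter is
x^2 - a y^2.  The second slot of the algebra is that expression itself rather
than a variable equal to it, so that the morphism structures below need no
hypothesis. *)
Definition quat_mx (q : quat a b) : 'M[F]_2 :=
  \matrix_(i, j)
    nth 0 (nth [::]
    [:: [:: qc q 0 + qc q 2 * x + qc q 3 * a * y;
            a * qc q 1 - a * y * qc q 2 - a * x * qc q 3];
        [:: qc q 1 + qc q 2 * y + qc q 3 * x;
            qc q 0 - qc q 2 * x - qc q 3 * a * y]] i) j.

Lemma mx2P (M N : 'M[F]_2) :
  M ord0 ord0 = N ord0 ord0 -> M ord0 ord_max = N ord0 ord_max ->
  M ord_max ord0 = N ord_max ord0 -> M ord_max ord_max = N ord_max ord_max ->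
  M = N.
Proof.
have ordE (i : 'I_2) : i = ord0 \/ i = ord_max.
  by case: i => [[|[|i]] hi] //; [left | right]; apply: val_inj.
move=> h00 h01 h10 h11; apply/matrixP => i j.
by have [->|->] := ordE i; have [->|->] := ordE j.
Qed.

Fact quat_mx_linear : linear quat_mx.
Proof.
by move=> c q r; apply: mx2P; rewrite !mxE /= !qcD !qcZ; ring.
Qed.
HB.instance Definition _ := GRing.isLinear.Build F (quat a b) 'M[F]_2 _
  quat_mx quat_mx_linear.

Fact quat_mx_monoid : monoid_morphism quat_mx.
Proof.
split.
  by apply: mx2P; rewrite -idmxE !mxE /= !qc1; ring.
move=> q r; apply: mx2P;
  rewrite !mxE !big_ord_recl big_ord0 !mxE /= !qcM; ring.
Qed.
HB.instance Definition _ := GRing.isMonoidMorphism.Build (quat a b) 'M[F]_2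
  quat_mx quat_mx_monoid.

(** The inverse reads the coordinates off the traces of M, M I, M J, M I J. *)
Lemma quat_mx_bij : a != 0 -> b != 0 -> bijective quat_mx.
Proof.
move=> a0 b0.
exists (fun M : 'M_2 =>
  let S := (M ord0 ord0 - M ord_max ord_max) / 2%:R in
  let T := (M ord_max ord0 - M ord0 ord_max / a) / 2%:R in
  mkquat a b ((M ord0 ord0 + M ord_max ord_max) / 2%:R)
    ((M ord0 ord_max / a + M ord_max ord0) / 2%:R)
    ((S * x - a * y * T) / b) ((x * T - y * S) / b)).
  by move=> q; apply: quatP; rewrite !qc_mk !mxE /=; field; rewrite ?a0 ?b0 ?two0.
by move=> M; apply: mx2P; rewrite !mxE /= !qc_mk; field; rewrite ?a0 ?b0 ?two0.
Qed.
End Matrix.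

Lemma is_norm_split a b : a != 0 -> b != 0 -> is_norm a b -> quat_split a b.
Proof.
move=> a0 b0 [[x y] /= e]; subst b; exists (quat_mx (a:=a) (x:=x) (y:=y)).
exact: quat_mx_bij.
Qed.

Lemma alg_isom_zero_div (A B : algType F) :
  alg_isom A B -> has_zero_divisors A <-> has_zero_divisors B.
Proof.
move=> [f [g fK gK]]; have fI := can_inj fK; have gI := can_inj gK.
have g0 : g 0 = 0 by rewrite -(rmorph0 f) fK.
split=> -[q q0 [r r0 qr]].
  exists (f q); first by rewrite -(rmorph0 f) (inj_eq fI).
  by exists (f r); [rewrite -(rmorph0 f) (inj_eq fI) | rewrite -rmorphM qr rmorph0].
exists (g q); first by rewrite -g0 (inj_eq gI).
exists (g r); first by rewrite -g0 (inj_eq gI).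
by apply: fI; rewrite rmorphM rmorph0 /= !gK.
Qed.

Lemma mx2_zero_div : has_zero_divisors 'M[F]_2.
Proof.
exists (delta_mx ord0 ord_max : 'M_2).
  by apply/eqP => /matrixP/(_ ord0 ord_max)/eqP; rewrite !mxE oner_eq0.
exists (delta_mx ord0 ord_max : 'M_2); last by rewrite -mulmxE mul_delta_mx_0.
by apply/eqP => /matrixP/(_ ord0 ord_max)/eqP; rewrite !mxE oner_eq0.
Qed.

Lemma split_is_norm a b : a != 0 -> b != 0 -> quat_split a b -> is_norm a b.
Proof.
move=> a0 b0 /alg_isom_zero_div[_ h]; apply: zero_div_is_norm => //.
exact/h/mx2_zero_div.
Qed.

Definition qi a b := mkquat a b 0 1 0 0.
Definition qj a b := mkquat a b 0 0 1 0.

Lemma qi_sq a b : qi a b * qi a b = a%:A.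
Proof. by apply: quatP; rewrite !qcM !qcA !qc_mk; ring. Qed.

Lemma qj_sq a b : qj a b * qj a b = b%:A.
Proof. by apply: quatP; rewrite !qcM !qcA !qc_mk; ring. Qed.

Lemma qij a b : qi a b * qj a b = - (qj a b * qi a b).
Proof. by apply: quatP; rewrite !(qcN, qcM) !qc_mk; ring. Qed.

(** Lets [ring] use one linear equation as a hypothesis. *)
Lemma eq0_of_sub x y z : x = y -> z = x - y -> z = 0.
Proof. by move=> -> ->; rewrite subrr. Qed.

(** The elements anticommuting with i are the combinations of j and k, that
is, the products of j by elements of F(i). *)
Lemma anticomm_qi a b c (e : quat a b) : a != 0 ->
  qi a b * e = - (e * qi a b) -> e * e = c%:A ->
  c = b * (qc e 2 ^+ 2 - a * qc e 3 ^+ 2).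
Proof.
move=> a0 ie ee.
have mul2 x : 2%:R * x = 0 -> x = 0.
  by move/eqP; rewrite mulf_eq0 (negPf two0) => /eqP.
have e1 : qc e 1 = 0.
  apply: mul2; apply: (mulfI a0); rewrite mulr0.
  have /(congr1 (fun q : quat a b => qc q 0)) := ie.
  by rewrite !(qcN, qcM) !qc_mk => h; apply: (eq0_of_sub h); ring.
have e0 : qc e 0 = 0.
  apply: mul2; have /(congr1 (fun q : quat a b => qc q 1)) := ie.
  by rewrite !(qcN, qcM) !qc_mk => h; apply: (eq0_of_sub h); ring.
have /(congr1 (fun q : quat a b => qc q 0)) := ee.
by rewrite qcA qcM e0 e1 => <-; ring.
Qed.

(** If the scalar part of p were nonzero, p p in F would make p scalar, so
p q = - q p would give q = 0. *)
Lemma pure_of_anticomm a b c d (p q : quat a b) : d != 0 ->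
  p * p = c%:A -> q * q = d%:A -> p * q = - (q * p) -> qc p 0 = 0.
Proof.
move=> d0 pp qq pq; apply/eqP; apply: contraT => p0; exfalso.
have mul2 x : 2%:R * (qc p 0 * x) = 0 -> x = 0.
  by move/eqP; rewrite !mulf_eq0 (negPf two0) (negPf p0) => /eqP.
have p1 : qc p 1 = 0.
  apply: mul2; have /(congr1 (fun q : quat a b => qc q 1)) := pp.
  by rewrite qcM qcA => <-; ring.
have p2 : qc p 2 = 0.
  apply: mul2; have /(congr1 (fun q : quat a b => qc q 2)) := pp.
  by rewrite qcM qcA => <-; ring.
have p3 : qc p 3 = 0.
  apply: mul2; have /(congr1 (fun q : quat a b => qc q 3)) := pp.
  by rewrite qcM qcA => <-; ring.
have q0 i : (i < 4)%N -> qc q i = 0.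
  move=> i4; apply: mul2; have /(congr1 (fun q : quat a b => qc q i)) := pq.
  by case: i i4 => [|[|[|[|i]]]] // _; rewrite qcN !qcM p1 p2 p3 => h;
    apply: (eq0_of_sub h); ring.
have /(congr1 (fun q : quat a b => qc q 0)) := qq.
rewrite qcA qcM !q0 // => dE; move/eqP: d0; apply; rewrite -dE; ring.
Qed.

End Quaternions.

Section QuatSymbol.
Variables (F : fieldType) (K : sepClosure F).
Hypothesis char2 : 2%N \notin [pchar F].
Local Notation sym := (sym K).
Let two0 := two_neq0 char2.

Lemma is_norm_sym_eq0 a b : b != 0 -> is_norm a b -> sym a b = 0.
Proof. by move=> b0 [[x y] /= e]; exact: (sym_of_norm_eq0 K char2 b0 e). Qed.

(** Changing b by a norm from F(sqrt a) does not change the symbol. *)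
Lemma sym_slot a b c : a != 0 -> b != 0 -> c != 0 ->
  (exists n, c = b * n /\ is_norm a n) -> sym a c = sym a b.
Proof.
move=> a0 b0 c0 [n [cE n_norm]].
have n0 : n != 0 by apply: contraNneq c0 => n0; rewrite cE n0 mulr0.
by rewrite cE symMr // (is_norm_sym_eq0 n0 n_norm) addr0.
Qed.

(** Identify both algebras with Q = (a', b'), and let p in Q be the image of
the generator i of (a, b).  Some nonzero e in the span of j' and k'
anticommutes with p; it also anticommutes with i'.  If c = e^2, then
(a, b) = (a, c) = (a', c) = (a', b') as symbols, each step changing one slot by
a norm.  When Q has zero divisors c could be 0, but then both symbols
vanish. *)
Lemma isom_sym a b a' b' : a != 0 -> b != 0 -> a' != 0 -> b' != 0 ->
  alg_isom (quat a b) (quat a' b') -> sym a b = sym a' b'.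
Proof.
move=> a0 b0 a'0 b'0 iso; have zd := alg_isom_zero_div iso.
have [z|nz] := pselect (has_zero_divisors (quat a b)).
  rewrite !is_norm_sym_eq0 //; first exact: (zero_div_is_norm two0 a'0 b'0 (zd.1 z)).
  exact: (zero_div_is_norm two0 a0 b0 z).
have {zd}nz' : ~ has_zero_divisors (quat a' b') by move=> /zd.
case: iso => f [g fK gK].
have sE (q : quat a b) c : q * q = c%:A -> f q * f q = c%:A.
  by move=> h; rewrite -rmorphM h; exact: (rmorph_alg f c).
pose p := f (qi a b); pose q := f (qj a b).
have pp : p * p = a%:A := sE _ _ (qi_sq a b).
have qq : q * q = b%:A := sE _ _ (qj_sq a b).
have pq : p * q = - (q * p) by rewrite -!rmorphM -rmorphN qij.
have p0 : qc p 0 = 0 := pure_of_anticomm two0 b0 pp qq pq.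
pose X := qc p 1; pose Y := qc p 2; pose Z := qc p 3.
have aE : a = a' * X ^+ 2 + b' * (Y ^+ 2 - a' * Z ^+ 2).
  have /(congr1 (fun q : quat a' b' => qc q 0)) := pp.
  by rewrite qcA qcM p0 -/X -/Y -/Z => <-; ring.
have [s [t [st [pe [y ay]]]]] : exists s t, (s, t) != (0, 0) /\
    (b' * (Y * s - a' * (Z * t)) = 0 /\ exists y,
      a = a' * (X ^+ 2 - b' * (s ^+ 2 - a' * t ^+ 2) * y ^+ 2)).
  (* e = s j' + t k' anticommutes with p = X i' + Y j' + Z k' iff
     Y s = a' Z t; then p is X i' + y i' e for some y in F *)
  have [YZ|YZ] := eqVneq (Y, Z) (0, 0).
    exists 1, 0; split; first by rewrite xpair_eqE oner_eq0.
    case: YZ aE => -> -> aE; split; first by ring.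
    by exists 0; rewrite aE; ring.
  exists (a' * Z), Y; split.
    apply: contraNneq YZ => -[/eqP]; rewrite mulf_eq0 (negPf a'0) => /eqP -> ->.
    by [].
  split; first by ring.
  by exists a'^-1; rewrite aE; field.
pose e := mkquat a' b' 0 0 s t.
pose c := b' * (s ^+ 2 - a' * t ^+ 2).
have ee : e * e = c%:A.
  by apply: quatP; rewrite qcM qcA !qc_mk /c; ring.
have e0 : e != 0.
  apply: contraNneq st => e0.
  have <- : qc e 2 = s by rewrite qc_mk.
  have <- : qc e 3 = t by rewrite qc_mk.
  by rewrite e0 !qc0.
have c0 : c != 0.
  apply/eqP => c0; apply: nz'; exists e => //; exists e => //.
  by rewrite ee c0 scale0r.
have pe' : p * e = - (e * p).
  apply: quatP; rewrite qcN !qcM !qc_mk p0 -/X -/Y -/Z; try ring.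
  apply: subr0_eq; apply: (eq0_of_sub (congr1 ( *%R 2%:R) pe)); ring.
have sac' : sym a' c = sym a' b'.
  by apply: sym_slot => //; exists (s ^+ 2 - a' * t ^+ 2); split => //; exists (s, t).
rewrite -sac'.
have -> : sym a' c = sym a c.
  rewrite !(symC K _ c); symmetry; apply: sym_slot => //.
  by exists (X ^+ 2 - c * y ^+ 2); split => //; exists (X, y).
symmetry; apply: sym_slot => //; pose e' := g e.
have fI := can_inj fK.
have ie' : qi a b * e' = - (e' * qi a b).
  by apply: fI; rewrite rmorphN !rmorphM /= gK.
have ee' : e' * e' = c%:A.
  apply: fI; rewrite rmorphM /= gK ee; symmetry; exact: (rmorph_alg f c).
exists (qc e' 2 ^+ 2 - a * qc e' 3 ^+ 2); split; last by exists (qc e' 2, qc e' 3).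
exact: (anticomm_qi two0 a0 ie' ee').
Qed.

End QuatSymbol.

(** * Automorphisms of a separable closure *)

Section Galois.
Variables (F : fieldType) (K : sepClosure F).
Local Notation iota := (sepclosure_in K).
Local Notation "p ^i" := (map_poly (sepclosure_in K) p) (at level 2, format "p ^i").
Local Notation G := (Defs.gal K).
Implicit Types (A B : set (K * K)) (x y : K).

Lemma separable_monic_split (q : {poly K}) : separable_poly q -> q \is monic ->
  exists rs, q = \prod_(z <- rs) ('X - z%:P).
Proof.
move: {2}(size q) (leqnn (size q)) => n; elim: n q => [|n IHn] q qn qsep qmon.
  by move: qn; rewrite leqn0 size_poly_eq0 (negPf (monic_neq0 qmon)).
have [q1|q1] := leqP (size q) 1.
  have /size_poly1P[c c0 qE] : size q == 1%N.
    by rewrite eqn_leq q1 size_poly_gt0 monic_neq0.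
  move: qmon; rewrite qE monicE lead_coefC => /eqP ->.
  by exists [::]; rewrite big_nil.
have [z] := sepclosure_closed qsep q1; move=> /factor_theorem[t tE].
have tmon : t \is monic by rewrite -(monicMr _ (monicXsubC z)) -tE.
have [||rs rsE] := IHn t _ _ tmon.
- by move: qn; rewrite tE size_Mmonic ?monicXsubC ?monic_neq0 // size_XsubC addn2.
- by move: qsep; rewrite tE separable_mul => /and3P[].
by exists (z :: rs); rewrite big_cons -rsE tE mulrC.
Qed.

Lemma monic_separable x : exists p : {poly F},
  [/\ p \is monic, separable_poly p & root p^i x].
Proof.
have [p psep px] := sepclosure_separable x.
have p0 := separable_poly_neq0 psep.
have lp : (lead_coef p)^-1 != 0 by rewrite invr_eq0 lead_coef_eq0.
exists ((lead_coef p)^-1 *: p); split.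
- by rewrite monicE lead_coefZ mulVf // lead_coef_eq0.
- by rewrite (eqp_separable (eqp_scale p lp)).
- by rewrite map_polyZ rootZ // fmorph_eq0.
Qed.

Definition sub_algebra A :=
  [/\ forall a, A (iota a, iota a),
      forall p q, A p -> A q -> A (p + q)
    & forall p q, A p -> A q -> A (p * q)].

(** An F-subalgebra A of K x K is the graph of an isomorphism between two
subfields of K as soon as it omits (0, 1): see [partial_iso_fun] and
[partial_iso_inj].  Such a condition passes to unions of chains at once, and
no polynomial needs to be transported along an isomorphism. *)
Definition partial_iso A := sub_algebra A /\ ~ A (0, 1).

Definition swap A : set (K * K) := [set p | A (p.2, p.1)].

Section SubAlgebra.
Variable A : set (K * K).
Hypothesis AS : sub_algebra A.

Lemma sub_algebra0 : A 0.
Proof. by have [h _ _] := AS; have := h 0; rewrite rmorph0. Qed.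

Lemma sub_algebra1 : A 1.
Proof. by have [h _ _] := AS; have := h 1; rewrite rmorph1. Qed.

Lemma sub_algebraB p q : A p -> A q -> A (p - q).
Proof.
have [hF hD hM] := AS; move=> Ap Aq; apply: hD => //.
rewrite -mulN1r; apply: hM => //.
have := hF (-1); by rewrite rmorphN1.
Qed.

Lemma sub_algebra_sum (I : Type) (r : seq I) (f : I -> K * K) :
  (forall i, A (f i)) -> A (\sum_(i <- r) f i).
Proof.
by have [_ hD _] := AS; move=> h; apply: (big_ind A) => //; exact: sub_algebra0.
Qed.

(** Pairs of polynomials over K with the coefficients of like degree in A:
this is A[X], seen inside K[X] x K[X]. *)
Definition coefs_in (f g : {poly K}) := forall i, A (f`_i, g`_i).

Lemma coefs_inD f g f' g' : coefs_in f g -> coefs_in f' g' ->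
  coefs_in (f + f') (g + g').
Proof. by have [_ hD _] := AS; move=> h h' i; rewrite !coefD; apply: hD (h i) (h' i). Qed.

Lemma coefs_inB f g f' g' : coefs_in f g -> coefs_in f' g' ->
  coefs_in (f - f') (g - g').
Proof. by move=> h h' i; rewrite !coefB; apply: sub_algebraB (h i) (h' i). Qed.

Lemma pair_sum (I : Type) (r : seq I) (f g : I -> K) :
  (\sum_(i <- r) f i, \sum_(i <- r) g i) = \sum_(i <- r) (f i, g i).
Proof. by elim: r => [|i r IHr]; rewrite ?big_nil // !big_cons -IHr. Qed.

Lemma coefs_inM f g f' g' : coefs_in f g -> coefs_in f' g' ->
  coefs_in (f * f') (g * g').
Proof.
have [_ _ hM] := AS; move=> h h' i; rewrite !coefM pair_sum.
by apply: sub_algebra_sum => j; apply: hM (h j) (h' _).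
Qed.

Lemma coefs_inF (p : {poly F}) : coefs_in p^i p^i.
Proof. by have [hF _ _] := AS; move=> i; rewrite coef_map; apply: hF. Qed.

Lemma coefs_inC x y : A (x, y) -> coefs_in x%:P y%:P.
Proof. by move=> h i; rewrite !coefC; case: ifP => // _; exact: sub_algebra0. Qed.

Lemma coefs_in_horner f g x y : coefs_in f g -> A (x, y) -> A (f.[x], g.[y]).
Proof.
have [_ _ hM] := AS; move=> fg xy.
have pw k : A (x ^+ k, y ^+ k).
  elim: k => [|k IHk]; first exact: sub_algebra1.
  by rewrite !exprS; apply: (hM (_, _) (_, _)).
pose n := maxn (size f) (size g).
rewrite (@horner_coef_wide _ n) ?leq_maxl // (@horner_coef_wide _ n) ?leq_maxr //.
rewrite pair_sum; apply: sub_algebra_sum => i; exact: (hM (_, _) (_, _) (fg i) (pw i)).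
Qed.

(** Division by a monic p in F[X] can be carried out within A[X]. *)
Lemma coefs_in_mod (p : {poly F}) : p \is monic -> (0 < size p)%N ->
  forall f g, coefs_in f g ->
  exists r s, [/\ coefs_in r s, (size r < size p)%N, (size s < size p)%N,
     p^i %| f - r & p^i %| g - s].
Proof.
move=> pmon p0 f g.
have fn : (size f <= maxn (size f) (size g))%N by rewrite leq_maxl.
have gn : (size g <= maxn (size f) (size g))%N by rewrite leq_maxr.
move: (maxn _ _) fn gn => n; elim: n f g => [|n IHn] f g fn gn fg.
  exists f, g; split=> //; rewrite ?subrr ?dvdp0 //; exact: leq_ltn_trans p0.
have [np|pn] := ltnP n.+1 (size p).
  exists f, g; split=> //; rewrite ?subrr ?dvdp0 //; exact: leq_ltn_trans np.
have red (h : {poly K}) : (size h <= n.+1)%N ->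
    (size (h - (h`_n)%:P * ('X^(n.+1 - size p)%N * p)^i)%R <= n)%N.
  move=> hn; apply/leq_sizeP => j; rewrite leq_eqVlt => /orP[/eqP <-|nj].
    rewrite coefB coefCM coef_map coefXnM /=.
    have -> : (n < n.+1 - size p)%N = false.
      by apply/negbTE; rewrite -leqNgt leq_subLR addnC -addn1 leq_add2l.
    have -> : (n - (n.+1 - size p) = (size p).-1)%N.
      by move: p0 pn; case: (size p) => // k _ kn; rewrite subSS subKn.
    have -> : p`_(size p).-1 = 1 by apply/eqP.
    by rewrite rmorph1 mulr1 subrr.
  have Xp0 : ('X^(n.+1 - size p)%N * p)`_j = 0.
    apply: nth_default; apply: leq_trans (size_polyMleq _ _) _.
    by rewrite size_polyXn addSn /= subnK.
  by rewrite coefB coefCM coef_map /= Xp0 rmorph0 mulr0 subr0 (leq_sizeP _ _ hn).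
have [] := IHn (f - (f`_n)%:P * ('X^(n.+1 - size p)%N * p)^i)
               (g - (g`_n)%:P * ('X^(n.+1 - size p)%N * p)^i).
- exact: red.
- exact: red.
- apply: coefs_inB => //; apply: coefs_inM; last exact: coefs_inF.
  exact: coefs_inC.
move=> r [s [rs rp sp fr gs]]; exists r, s; split=> //.
- rewrite -(dvdp_addl _ (_ : _ %| - ((f`_n)%:P * ('X^(n.+1 - size p)%N * p)^i))).
    by rewrite addrAC.
  by rewrite rmorphM /= -mulNr mulrA dvdp_mulIr.
- rewrite -(dvdp_addl _ (_ : _ %| - ((g`_n)%:P * ('X^(n.+1 - size p)%N * p)^i))).
    by rewrite addrAC.
  by rewrite rmorphM /= -mulNr mulrA dvdp_mulIr.
Qed.

(** The algebra A[(x, y)]. *)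
Definition adjoin x y : set (K * K) :=
  [set p | exists f g, coefs_in f g /\ p = (f.[x], g.[y])].

Lemma adjoin_sub_algebra x y : sub_algebra (adjoin x y).
Proof.
split=> [a|_ _ [f [g [fg ->]]] [f' [g' [fg' ->]]]
           |_ _ [f [g [fg ->]]] [f' [g' [fg' ->]]]].
- exists (iota a)%:P, (iota a)%:P; split; last by rewrite !hornerC.
  by apply: coefs_inC; have [] := AS.
- by exists (f + f'), (g + g'); split; [exact: coefs_inD | rewrite !hornerD].
- by exists (f * f'), (g * g'); split; [exact: coefs_inM | rewrite !hornerM].
Qed.

Lemma adjoin_sub x y : A `<=` adjoin x y.
Proof.
by move=> [u v] uv; exists u%:P, v%:P; split; [exact: coefs_inC | rewrite !hornerC].
Qed.

Lemma adjoin_mem x y : adjoin x y (x, y).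
Proof.
exists ('X : {poly F})^i, ('X : {poly F})^i; split; first exact: coefs_inF.
by rewrite map_polyX !hornerX.
Qed.

End SubAlgebra.

Lemma partial_iso_swap A : partial_iso A -> partial_iso (swap A).
Proof.
move=> [AS A01]; split; last first.
  move=> /= A10; apply: A01; have := sub_algebraB AS (sub_algebra1 AS) A10.
  by congr A; congr pair; rewrite /= ?subrr ?subr0.
have [hF hD hM] := AS; split=> [a|p q|p q]; first exact: hF.
  exact: hD.
exact: hM.
Qed.

(** x is a root of some q in F[X] with q(0) nonzero, unless x = 0.  Evaluating
q at (x, 0) shows that A contains (0, q(0)), hence (0, 1). *)
Lemma partial_iso_inj A x : partial_iso A -> A (x, 0) -> x = 0.
Proof.
move=> [AS A01] Ax0; apply: contrapT => /eqP x0; apply: A01.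
have [p psep px] := sepclosure_separable x.
have p0 := separable_poly_neq0 psep.
have [m [q]] := multiplicity_XsubC p 0; rewrite p0 /= => q0 pE.
have qx : q^i.[x] = 0.
  move: px; rewrite pE polyC0 subr0 rmorphM rmorphXn /= map_polyX.
  rewrite rootM => /orP[/rootP//|].
  by rewrite /root hornerXn expf_eq0 (negPf x0) andbF.
have := coefs_in_horner AS (coefs_inF AS q) Ax0.
rewrite qx -(rmorph0 iota) horner_map rmorph0.
have [hF _ hM] := AS.
move=> /hM /(_ (hF (q.[0])^-1)); congr A; congr pair => /=; rewrite ?mul0r //.
by rewrite -rmorphM mulfV ?rmorph1.
Qed.

Lemma partial_iso_fun A y : partial_iso A -> A (0, y) -> y = 0.
Proof. by move=> /partial_iso_swap h Ay; apply: (partial_iso_inj h). Qed.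

(** Let p in F[X] be monic and separable with root x, so that it splits in K.
If A[(x, y)] contains (0, 1) for each root y of p, say f(x) = 0 and g(y) = 1 with
(f, g) in A[X], then the product of the pairs (1 - f, 1 - g) is some (h, k) in
A[X] with h(x) = 1 and k vanishing at all roots of p.  Modulo p,
k becomes 0, hence so does h because A is the graph of a bijection; this
contradicts h(x) = 1. *)
Lemma partial_iso_extend A x : partial_iso A ->
  exists B y, [/\ partial_iso B, A `<=` B & B (x, y)].
Proof.
move=> Aiso; have AS := Aiso.1.
apply: contrapT => no.
have bad y : exists f g, [/\ coefs_in A f g, f.[x] = 0 & g.[y] = 1].
  have : adjoin A x y (0, 1).
    apply: contrapT => h; apply: no; exists (adjoin A x y), y; split.
    - by split=> //; apply: adjoin_sub_algebra.
    - exact: adjoin_sub.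
    - exact: adjoin_mem.
  by move=> [f [g [fg [-> ->]]]]; exists f, g.
have [p [pmon psep px]] := monic_separable x.
have [rs pE] : exists rs, p^i = \prod_(z <- rs) ('X - z%:P).
  by apply: separable_monic_split; rewrite ?separable_map ?map_monic.
have rs_uniq : uniq rs by rewrite -separable_prod_XsubC -pE separable_map.
have [h [k [hk hx kr]]] : exists h k, [/\ coefs_in A h k, h.[x] = 1
    & {in rs, forall y, k.[y] = 0}].
  elim: rs {pE rs_uniq} => [|y rs [h [k [hk hx kr]]]].
    exists 1, 1; split; rewrite ?hornerC //.
    by have := coefs_inF AS 1; rewrite rmorph1.
  have [f [g [fg fx gy]]] := bad y.
  exists ((1 - f) * h), ((1 - g) * k); split.
  - apply: coefs_inM => //; apply: coefs_inB => //.
    by have := coefs_inF AS 1; rewrite rmorph1.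
  - by rewrite !hornerE fx hx subr0 mulr1.
  - move=> z; rewrite inE !hornerE => /orP[/eqP->|/kr ->]; rewrite ?mulr0 //.
    by rewrite gy subrr mul0r.
have p_gt0 : (0 < size p)%N by rewrite size_poly_gt0 monic_neq0.
have [r [s [rs_in rp sp hr ks]]] := coefs_in_mod AS pmon p_gt0 hk.
(* s has degree less than that of p and vanishes at all its roots *)
have s0 : s = 0.
  apply: (@roots_geq_poly_eq0 _ s rs) => //.
    apply/allP => y yrs; apply/rootP.
    move: ks => /dvdpP[q /(congr1 (fun f => f.[y]))].
    have -> : (q * p^i).[y] = 0.
      rewrite hornerM (_ : (p^i).[y] = 0) ?mulr0 //.
      by apply/rootP; rewrite pE root_prod_XsubC.
    by rewrite hornerD hornerN kr // sub0r => /eqP; rewrite oppr_eq0 => /eqP.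
  have := size_prod_XsubC rs id; rewrite -pE size_map_poly => e.
  by rewrite -ltnS -e.
have r0 : r = 0.
  apply/polyP => i; rewrite coef0; apply: (partial_iso_inj Aiso).
  by have := rs_in i; rewrite s0 coef0.
move: hr; rewrite r0 subr0 => /dvdpP[q qE].
by have := oner_neq0 K; rewrite -hx qE hornerM (rootP px) mulr0 eqxx.
Qed.

(** A maximal graph is total on both sides by [partial_iso_extend], applied to
it and to its transpose. *)
Lemma partial_iso_gal A : partial_iso A ->
  exists s : G, forall x y, A (x, y) -> s x = y.
Proof.
move=> Aiso.
(* the empty set is admitted only because it is the union of the empty chain *)
pose P B := B = set0 \/ partial_iso B /\ A `<=` B.
have [|B [PB Bmax]] := @Zorn_bigcup _ P.
  move=> C CP Ctot.
  have [C0|/existsNP[B0 /not_implyP[CB0 B0n0]]] :=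
    pselect (forall B, C B -> B = set0).
    by left; apply/seteqP; split => // p [B CB]; rewrite (C0 B CB).
  have isoP B p : C B -> B p -> partial_iso B /\ A `<=` B.
    by move=> CB Bp; case: (CP B CB) => // B0'; move: Bp; rewrite B0'.
  have [//|[B0iso AB0]] := CP B0 CB0.
  have join p q : (\bigcup_(B in C) B) p -> (\bigcup_(B in C) B) q ->
      exists B, [/\ C B, B p & B q].
    move=> [B CB Bp] [B' CB' Bq].
    by have [h|h] := Ctot _ _ CB CB'; [exists B' | exists B]; split => //; apply: h.
  right; split; last by move=> p /AB0 B0p; exists B0.
  split; last by move=> [B CB B01]; have [[_ h] _] := isoP B _ CB B01.
  have [[hF _ _] _] := B0iso.
  split=> [a|p q hp hq|p q hp hq]; first by exists B0.
    have [B [CB Bp Bq]] := join p q hp hq; exists B => //.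
    by have [[[_ hD _] _] _] := isoP B _ CB Bp; apply: hD.
  have [B [CB Bp Bq]] := join p q hp hq; exists B => //.
  by have [[[_ _ hM] _] _] := isoP B _ CB Bp; apply: hM.
case: PB Bmax => [->|[Biso AB]] Bmax.
  exfalso; apply: (Bmax A); last by right; split.
  by split=> // A0; have := A0 _ (sub_algebra1 Aiso.1).
have fn x y y' : B (x, y) -> B (x, y') -> y = y'.
  move=> h h'; apply: subr0_eq; apply: (partial_iso_fun Biso).
  by have := sub_algebraB Biso.1 h h'; congr B; congr pair; rewrite /= subrr.
have inj x x' y : B (x, y) -> B (x', y) -> x = x'.
  move=> h h'; apply: subr0_eq; apply: (partial_iso_inj Biso).
  by have := sub_algebraB Biso.1 h h'; congr B; congr pair; rewrite /= subrr.
have maxE C : partial_iso C -> B `<=` C -> C `<=` B.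
  move=> Ciso BC; apply: contrapT => CB; apply: (Bmax C) => //.
  by right; split=> // p /AB /BC.
have /choice[s sB] x : exists y, B (x, y).
  have [C [y [Ciso BC Cxy]]] := partial_iso_extend x Biso.
  by exists y; apply: maxE Cxy.
have /choice[t tB] y : exists x, B (x, y).
  have [C [x [Ciso BC Cyx]]] := partial_iso_extend y (partial_iso_swap Biso).
  exists x; apply: (maxE (swap C)) => //; first exact: partial_iso_swap.
  by move=> [u v] Buv; apply: BC.
have [[hF hD hM] _] := Biso.
have sP : gal_prop s.
  split=> [x y|x y||a].
  - by apply: fn (sB _) _; apply: (hD (_, _) (_, _)).
  - by apply: fn (sB _) _; apply: (hM (_, _) (_, _)).
  - by exists t => x; [apply: inj (tB _) (sB _) | apply: fn (sB _) (tB _)].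
  - exact: fn (sB _) (hF a).
by exists (mk_gal sP) => x y /AB Bxy; apply: fn Bxy.
Qed.

Lemma min_poly_exists x : exists m : {poly F},
  [/\ m != 0, root m^i x, separable_poly m
    & forall f : {poly F}, root f^i x -> m %| f].
Proof.
have [p psep px] := sepclosure_separable x.
pose Q n := `[< exists m : {poly F}, [/\ m != 0, root m^i x & size m = n] >].
have exQ : exists n, Q n.
  by exists (size p); apply/asboolP; exists p; split => //; exact: separable_poly_neq0.
case: (ex_minnP exQ) => n /asboolP[m [m0 mx mn]] nmin.
have mdiv f : root f^i x -> m %| f.
  move=> fx; apply: contraT => /eqP r0; exfalso.
  have rn : (size (f %% m)%R < n)%N by rewrite -mn ltn_modp.
  move: rn; rewrite ltnNge => /negP; apply; apply: nmin; apply/asboolP.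
  exists (f %% m); split=> //; first exact/eqP.
  move: fx; rewrite {1}(divp_eq f m) rmorphD rmorphM /= !rootE hornerD hornerM.
  by rewrite (rootP mx) mulr0 add0r.
by exists m; split=> //; apply: dvdp_separable psep; apply: mdiv.
Qed.

(** Otherwise the minimal polynomial of x over F has a second root x', and
F[(x, x')] is a partial isomorphism, which extends to an automorphism moving x
to x'. *)
Lemma gal_fixed x : (forall s : G, s x = x) -> exists a, x = iota a.
Proof.
move=> fx; apply: contrapT => nF.
have [m [m0 mx msep mdiv]] := min_poly_exists x.
have [t tE] := factor_theorem _ _ mx.
have tsep : separable_poly t && ~~ root t x.
  by rewrite -separable_root -tE separable_map.
case/andP: tsep => tsep tx.
have t1 : (1 < size t)%N.
  rewrite ltnNge; apply/negP => t1.
  have t0 : t != 0.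
    by apply: contraNneq m0 => t0; rewrite -(map_poly_eq0 iota) tE t0 mul0r.
  have /size_poly1P[c c0 cE] : size t == 1%N by rewrite eqn_leq t1 size_poly_gt0.
  apply: nF; exists (- m`_0 / m`_1).
  rewrite fmorph_div rmorphN -!(coef_map iota) tE cE.
  by rewrite !coefCM !coefB !coefX !coefC /= sub0r subr0 mulr1 mulrN opprK mulrC mulKf.
have [x' x't] := sepclosure_closed tsep t1.
have mx' : root m^i x' by rewrite tE rootM x't.
pose A : set (K * K) := [set p | exists f : {poly F}, p = (f^i.[x], f^i.[x'])].
have Aiso : partial_iso A.
  split; last first.
    move=> [f [fx0 fx1]]; have /mdiv/dvdpP[q qE] : root f^i x by apply/rootP.
    have := oner_neq0 K.
    by rewrite fx1 qE rmorphM /= hornerM (rootP mx') mulr0 eqxx.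
  split=> [a|_ _ [f ->] [g ->]|_ _ [f ->] [g ->]].
  - by exists a%:P; rewrite map_polyC !hornerC.
  - by exists (f + g); rewrite rmorphD /= !hornerD.
  - by exists (f * g); rewrite rmorphM /= !hornerM.
have [s sA] := partial_iso_gal Aiso.
have := sA x x'; rewrite fx => xx'; move: tx; rewrite xx' ?x't //.
by exists 'X; rewrite map_polyX !hornerX.
Qed.

Lemma gal_orbit_finite (S : seq K) :
  exists C : seq (seq K), forall s : G, map s S \in C.
Proof.
elim: S => [|x S [C hC]]; first by exists [:: [::]] => s; rewrite mem_seq1.
have [p [pmon psep px]] := monic_separable x.
have [rs pE] : exists rs, p^i = \prod_(z <- rs) ('X - z%:P).
  by apply: separable_monic_split; rewrite ?separable_map ?map_monic.
exists (allpairs cons rs C) => s /=; apply: allpairs_f => //.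
rewrite -root_prod_XsubC -pE.
have -> : p^i = map_poly s p^i.
  by rewrite -map_poly_comp; apply: eq_map_poly => a /=; rewrite gal_in.
by rewrite rmorph_root.
Qed.

(** The N-orbit of S, viewed as a finite set of polynomials in an auxiliary
variable, is the set of roots of a polynomial Q whose coefficients are fixed by
N, hence by tau.  So tau permutes these roots, and tau S is in the N-orbit of
S.  Encoding S by a polynomial treats its elements simultaneously, without a
primitive element. *)
Lemma gal_density (N : set G) (tau : G) (S : seq K) :
  N 1%g -> (forall s t, N s -> N t -> N (s * t)%g) ->
  (forall x, (forall s : G, N s -> s x = x) -> tau x = x) ->
  exists2 s, N s & {in S, s =1 tau}.
Proof.
move=> N1 NM Nfix.
have [C hC] := gal_orbit_finite S.
pose O := undup [seq c <- C | `[< exists2 s, N s & c = map s S >]].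
have OP c : reflect (exists2 s, N s & c = map s S) (c \in O).
  rewrite mem_undup mem_filter; apply: (iffP andP) => [[/asboolP//]|h].
  by split; [apply/asboolP | case: h => s _ ->].
(* Q is kept abstract so that simplification does not unfold the product *)
have [Q QE] : exists Q, Q = \prod_(c <- O) ('X - (Poly c)%:P) by eexists.
have mapE (s : G) : map_poly (map_poly s) Q
    = \prod_(c <- [seq map s c | c <- O]) ('X - (Poly c)%:P).
  rewrite QE rmorph_prod big_map; apply: eq_bigr => c _.
  by rewrite rmorphB /= map_polyX map_polyC /= map_Poly.
have QN (s : G) : N s -> map_poly (map_poly s) Q = Q.
  move=> Ns; rewrite mapE QE; apply: perm_big.
  have sub : {subset [seq map s c | c <- O] <= O}.
    move=> _ /mapP[c /OP[t Nt ->] ->]; apply/OP; exists (s * t)%g; first exact: NM.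
    by rewrite -map_comp.
  have u : uniq [seq map s c | c <- O].
    by rewrite map_inj_uniq ?undup_uniq //; apply: inj_map; apply: fmorph_inj.
  apply: uniq_perm => //; first exact: undup_uniq.
  by have [] := uniq_min_size u sub; rewrite ?size_map.
have Qtau : map_poly (map_poly tau) Q = Q.
  apply/polyP => i; apply/polyP => j; rewrite !coef_map; apply: Nfix => s Ns.
  by have := congr1 (fun P : {poly {poly K}} => P`_i`_j) (QN s Ns); rewrite !coef_map.
have rootQ (c : seq K) : root Q (Poly c) = (Poly c \in [seq Poly d | d <- O]).
  by rewrite QE -root_prod_XsubC big_map.
have : root Q (Poly (map tau S)).
  rewrite -map_Poly -[Q]Qtau rmorph_root // rootQ map_f //.
  by apply/OP; exists 1%g => //; rewrite map_id_in.
rewrite rootQ => /mapP[c /OP[s Ns ->] e]; exists s => // x xS.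
have := congr1 (fun f : {poly K} => f`_(index x S)) e.
by rewrite !coef_Poly !(nth_map 0) ?index_mem // nth_index.
Qed.

End Galois.

(** * Symbols that vanish *)

Section Hilbert90.
Variables (F : fieldType) (K : sepClosure F).
Local Notation iota := (sepclosure_in K).
Local Notation G := (Defs.gal K).
Implicit Types (s t : G).
Hypothesis char2 : 2%N \notin [pchar F].

(** Hilbert 90 for a character of order 2: if tau in H has g tau = 1 and N is the
kernel of g on H, some x fixed by N is moved by tau (otherwise, by density, tau
would agree with an element of N on a set that determines g near 1), and
x - tau x changes sign under H exactly as g prescribes. *)
Lemma quadratic_hilbert90 (H : set G) (g : G -> 'F_2) :
  H 1%g -> (forall s t, H s -> H t -> H (s * t)%g) ->
  (forall s, H s -> H s^-1%g) -> locally_constant g ->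
  (forall s t, H s -> H t -> g (s * t)%g = g s + g t) ->
  exists2 d : K, d != 0 & forall s, H s -> s d = (-1) ^+ g s * d.
Proof.
move=> H1 HM HV glc gM.
have g1 : g 1%g = 0.
  by have /esym/eqP := gM _ _ H1 H1; rewrite mulg1 -subr_eq0 addrK => /eqP.
have gV s : H s -> g s^-1%g = g s.
  move=> Hs; have := gM _ _ (HV _ Hs) Hs; rewrite mulVg g1 => /esym h.
  exact: (eq_of_add_eq0 (@addFF2)).
have [g0|/existsNP[tau /not_implyP[Htau gtau]]] :=
    pselect (forall s, H s -> g s = 0).
  by exists 1; rewrite ?oner_eq0 // => s Hs; rewrite g0 // rmorph1 mulr1.
have {}gtau : g tau = 1 by have [] := F2P (g tau).
pose N s := H s /\ g s = 0.
have [S gS] := glc 1%g.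
have [x [xN xtau]] : exists x, (forall s, N s -> s x = x) /\ tau x <> x.
  apply: contrapT => no.
  have [|||n [Hn gn] nS] := @gal_density F K N tau S.
  - by split.
  - by move=> s t [Hs gs] [Ht gt]; split; [exact: HM | rewrite gM // gs gt addr0].
  - move=> x xN; apply: contrapT => xtau; apply: no; by exists x.
  have : g (n^-1 * tau)%g = 0.
    rewrite -g1; apply: gS => x xS.
    by rewrite Defs.galM -nS // -Defs.galM mulVg.
  by rewrite gM ?gV ?gn ?gtau //; exact: HV.
have conj s : H s -> g s = 1 -> s x = tau x.
  move=> Hs gs; have Nts : N (tau^-1 * s)%g.
    split; first by apply: HM => //; apply: HV.
    by rewrite gM ?gV ?gtau ?gs ?addFF2 //; apply: HV.
  by rewrite -{2}(xN _ Nts) -Defs.galM mulgA mulgV mul1g.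
exists (x - tau x); first by rewrite subr_eq0 eq_sym; apply/eqP.
move=> s Hs; rewrite rmorphB /= -Defs.galM.
have [gs|gs] := F2P (g s); rewrite gs.
  rewrite (xN s) // signF2_0 mul1r conj //; first exact: HM.
  by rewrite gM // gs gtau add0r.
rewrite (conj s) // signF2_1 (xN (s * tau)%g) ?mulN1r ?opprB //.
by split; [exact: HM | rewrite gM // gs gtau addFF2].
Qed.

(** Let g be a cochain with coboundary (a) (b), H the stabilizer of sqrt a and
rho outside H.  On H, g is a character, so Hilbert 90 gives d with
s d = (-1)^(g s) d.  The cocycle equation shows that d (rho d) transforms under
the whole group as sqrt b does, hence is c sqrt b with c in F.  Since d^2 lies in
F(sqrt a) and has norm (d (rho d))^2 = b c^2, dividing by c^2 makes b a norm. *)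
Lemma sym_eq0_is_norm (a b : F) : a != 0 -> b != 0 -> sym K a b = 0 -> is_norm a b.
Proof.
move=> a0 b0 /sym_eq0P[g glc ge].
have two0 := two_neq0 char2.
pose al := sqrt_in K char2 a; have alE : al ^+ 2 = iota a := sqrt_inE K char2 a.
have al0 : al != 0 := sqrt_in_neq0 K char2 a0.
pose be := sqrt_in K char2 b; have beE : be ^+ 2 = iota b := sqrt_inE K char2 b.
have be0 : be != 0 := sqrt_in_neq0 K char2 b0.
have [triv|/existsNP[rho rhoa]] := pselect (forall s, kummer a s = 0).
  have [r rE] : exists r, al = iota r.
    by apply: gal_fixed => s; rewrite (gal_sign s alE) triv signF2_0 mul1r.
  apply: (@square_is_norm F two0 a b r 1); rewrite ?oner_eq0 //.
  by apply: (fmorph_inj iota); rewrite expr1n mulr1 rmorphXn -rE.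
have {}rhoa : kummer a rho = 1 by have [] := F2P (kummer a rho).
pose H (s : G) := kummer a s = 0.
have k1 : kummer a (1%g : G) = 0.
  have /esym/eqP := kummerM a (1%g : G) 1%g.
  by rewrite mulg1 -subr_eq0 addrK => /eqP.
have kV s : kummer a s^-1%g = kummer a s.
  by apply: (eq_of_add_eq0 (@addFF2)); rewrite -kummerM mulVg.
have gM s t : H s -> g (s * t)%g = g s + g t.
  move=> Hs; have := ge s t.
  by rewrite Hs mul0r => /esym/(eq_of_add_eq0 (@addFF2)) <-.
have gM1 s t : kummer a s = 1 -> g (s * t)%g = g s + g t + kummer b t.
  move=> Hs; have := ge s t; rewrite Hs mul1r => ->.
  by rewrite addrA addFF2 add0r.
have HM s t : H s -> H t -> H (s * t)%g.
  by move=> Hs Ht; rewrite /H kummerM Hs Ht addr0.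
have HV s : H s -> H s^-1%g by rewrite /H kV.
have [|d d0 dE] := @quadratic_hilbert90 H g k1 HM HV glc.
  by move=> s t Hs _; exact: gM.
have rhoK s : kummer a s = 1 -> exists2 t, H t & s = (rho * t)%g.
  move=> sa; exists (rho^-1 * s)%g; last by rewrite mulgA mulgV mul1g.
  by rewrite /H kummerM kV rhoa sa addFF2.
have epsE s : s (d * rho d) = (-1) ^+ kummer b s * (d * rho d).
  have epsH t : H t -> t (d * rho d) = (-1) ^+ kummer b t * (d * rho d).
    move=> Ht; rewrite rmorphM /= dE // -Defs.galM.
    have [|u Hu uE] := rhoK (t * rho)%g; first by rewrite kummerM Ht rhoa add0r.
    rewrite uE Defs.galM dE // rmorphM rmorphXn rmorphN1 /=.
    have -> : kummer b t = g t + g u.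
      have e : g t = g u + kummer b u.
        apply: (addrI (g rho)); have := congr1 g uE; rewrite gM // gM1 // => e.
        by rewrite addrA -e addrC.
      have -> : kummer b t = kummer b u.
        by apply: (addrI (kummer b rho)); rewrite -[RHS]kummerM -uE kummerM addrC.
      by rewrite e addrAC addFF2 add0r.
    by rewrite signF2D; ring.
  have epsR : rho (d * rho d) = (-1) ^+ kummer b rho * (d * rho d).
    rewrite rmorphM /= -Defs.galM (dE (rho * rho)%g); last by rewrite /H kummerM addFF2.
    by rewrite gM1 // addFF2 add0r; ring.
  have [|sa] := F2P (kummer a s); first exact: epsH.
  have [t Ht tE] := rhoK s sa.
  rewrite tE Defs.galM epsH // rmorphM rmorphXn rmorphN1 /= epsR.
  by rewrite kummerM signF2D; ring.
have [c cE] : exists c, d * rho d / be = iota c.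
  apply: gal_fixed => s; rewrite fmorph_div /= epsE (gal_sign s beE).
  have sgn : (-1) ^+ kummer b s != 0 :> K by rewrite signr_eq0.
  by field; rewrite be0 sgn.
have rd0 : rho d != 0 by rewrite fmorph_eq0.
have c0 : c != 0 by rewrite -(fmorph_eq0 iota) -cE !mulf_neq0 ?invr_eq0.
pose z := d ^+ 2; pose z' := rho z.
have Hz s : H s -> s z = z.
  by move=> Hs; rewrite /z rmorphXn /= dE // exprMn sqrr_sign mul1r.
have rz' : rho z' = z.
  by rewrite /z' -Defs.galM Hz // /H kummerM rhoa addFF2.
have Hz' s : H s -> s z' = z'.
  move=> Hs; have [|u Hu uE] := rhoK (s * rho)%g.
    by rewrite kummerM Hs rhoa add0r.
  by rewrite /z' -Defs.galM uE Defs.galM Hz.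
have ral : rho al = - al.
  by rewrite (gal_sign rho alE) rhoa signF2_1 mulN1r.
have Hal s : H s -> s al = al.
  by move=> Hs; rewrite (gal_sign s alE) Hs signF2_0 mul1r.
have two0K := two_neq0K K char2.
have fixP x : (forall s, H s -> s x = x) -> rho x = x -> exists r, x = iota r.
  move=> Hx rx; apply: gal_fixed => s; have [|sa] := F2P (kummer a s); first exact: Hx.
  have [t Ht tE] := rhoK s sa.
  by rewrite tE Defs.galM Hx.
(* z = u + v sqrt a *)
have [u uE] : exists u, (z + z') / 2%:R = iota u.
  apply: fixP => [s Hs|]; rewrite fmorph_div rmorphD rmorph_nat /=.
    by rewrite Hz ?Hz'.
  by rewrite rz' addrC.
have [v vE] : exists v, (z - z') / (2%:R * al) = iota v.
  apply: fixP => [s Hs|]; rewrite fmorph_div rmorphB rmorphM rmorph_nat /=.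
    by rewrite Hz ?Hz' ?Hal.
  by rewrite rz' ral -/z'; field; rewrite ?oppr_eq0 ?two0K ?al0.
exists (u / c, v / c) => /=; apply: (fmorph_inj iota).
rewrite rmorphB rmorphXn (rmorphM iota a) rmorphXn !fmorph_div -uE -vE -cE -alE -beE /=.
have -> : z' = rho d ^+ 2 by rewrite /z' /z rmorphXn.
by rewrite /z; field; rewrite d0 rd0 al0 be0 two0K.
Qed.
End Hilbert90.

(** * Residues *)

(** Suppose t <> 0.  If m_i = 1 and n_j = 0 with i <> j, the equation (i, j)
says w_j = 0 and the equation (j, j) says t = m_j w_j = 0; so m_i = 1 implies
n_j = 1, and likewise n_i = 1 implies m_j = 1.  Through the third index a bit
equal to 1 spreads to all of them, and one of m_0, n_0 is 1 since t <> 0.  Then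
u_i + w_j + e = 0 for all i <> j; taking i = 2 gives w_0 = w_1, and
t = u_0 + w_0 + e = u_0 + w_1 + e = 0. *)
Lemma tame_form_eq0 (V : zmodType)
    (m n : 'I_3 -> bool) (u w : 'I_3 -> V) (e t : V) :
  (forall i j, i != j -> w j *+ m i + u i *+ n j + e *+ (m i && n j) = 0) ->
  (forall i, w i *+ m i + u i *+ n i + e *+ (m i && n i) = t) ->
  t = 0.
Proof.
move=> off diag; apply: contrapT => t0.
have mn i j : i != j -> m i -> n j.
  move=> ij mi; apply: contrapT => /negP/negPf nj; apply: t0.
  have := off _ _ ij; have := diag j; rewrite mi nj andbF mulr1n !mulr0n !addr0 => <- ->.
  by rewrite mul0rn.
have nm i j : i != j -> n i -> m j.
  move=> ij ni; apply: contrapT => /negP/negPf mj; apply: t0.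
  have := off j i; rewrite eq_sym ij => /(_ isT); have := diag j.
  by rewrite ni mj mulr1n !mulr0n !addr0 !add0r => <- ->; rewrite mul0rn.
pose i0 : 'I_3 := ord0; pose i1 : 'I_3 := lift ord0 ord0; pose i2 : 'I_3 := ord_max.
have m0 : m i0.
  apply: contrapT => /negP m0; have [n0|n0] := boolP (n i0).
    by apply: (negP m0); apply: (nm i1) => //; apply: (mn i2) => //; apply: (nm i0).
  by apply: t0; rewrite -(diag i0) (negPf m0) (negPf n0) !mulr0n !addr0.
have n1 : n i1 by apply: (mn i0).
have m2 : m i2 by apply: (nm i1).
have n0 : n i0 by apply: (mn i2).
apply: t0; rewrite -(diag i0) m0 n0.
have h01 := off i0 i1 isT; have h21 := off i2 i1 isT; have h20 := off i2 i0 isT.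
move: h01 h21 h20; rewrite m0 n1 m2 n0 /= !mulr1n => h01 h21 h20.
suff -> : w i0 = w i1 by [].
by apply: (addIr (u i2 + e)); rewrite !addrA h20 h21.
Qed.

Section Residues.
Variables (F : fieldType) (K : sepClosure F).
Hypothesis char2 : 2%N \notin [pchar F].
Variable v : discrete_valuation F.
Local Notation sym := (sym K).

Lemma dval_onto (q : int) : exists2 r : F, r != 0 & v r = q.
Proof.
have [p p0 vp] := dval_surj v.
have nat_case (n : nat) : exists2 r : F, r != 0 & v r = n%:Z.
  elim: n => [|n [r r0 vr]]; first by exists 1; rewrite ?oner_eq0 ?dval1.
  by exists (p * r); rewrite ?mulf_neq0 // dvalM // vp vr.
case: q => n; first exact: nat_case.
have [r r0 vr] := nat_case n.+1.
by exists r^-1; rewrite ?invr_eq0 // dvalV // vr NegzE.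
Qed.

Lemma unit_valring (a : F) : a != 0 -> v a = 0 ->
  exists2 u : valring v, residue u != 0 & val u = a.
Proof.
move=> a0 va.
have av : a \in valring_pred v by rewrite unfold_in va lexx orbT.
exists (ValRing av) => //.
by rewrite residue_eq0 unfold_in /= (negPf a0) va.
Qed.

Lemma unit_decomposition (p a : F) : p != 0 -> v p = 1 -> a != 0 ->
  exists (m : bool) (u : valring v) (r : F),
    [/\ residue u != 0, r != 0 & a = p ^+ m * val u * r ^+ 2].
Proof.
move=> p0 vp a0.
pose q := (v a %/ 2)%Z; pose m := ((v a %% 2)%Z == 1).
have vaE : v a = q + q + m%:Z.
  rewrite [LHS](divz_eq (v a) 2) -/q /m mulrC.
  have : (0 <= (v a %% 2)%Z < 2%:Z)%R by rewrite modz_ge0 // ltz_pmod.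
  by case: (v a %% 2)%Z => [[|[|k]]|k] //= _; rewrite mulrDl !mul1r.
have [r r0 vr] := dval_onto q.
have pm0 : p ^+ m != 0 by rewrite expf_neq0.
have vpm : v (p ^+ m) = m%:Z.
  by case: (m); rewrite ?expr1 // expr0 dval1.
have r20 : r ^+ 2 != 0 by rewrite expf_neq0.
have [||u ru uE] := @unit_valring (a / (p ^+ m * r ^+ 2)).
- by rewrite !mulf_neq0 // invr_eq0 mulf_neq0.
- rewrite dvalM ?invr_eq0 ?mulf_neq0 // dvalV ?mulf_neq0 // dvalM //.
  by rewrite expr2 dvalM // vpm vr vaE addrC [m%:Z + _]addrC addNr.
exists m, u, r; split => //; rewrite uE; field.
by rewrite pm0 r0.
Qed.

Lemma sym_sq_l a b r : a != 0 -> r != 0 -> sym (a * r ^+ 2) b = sym a b.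
Proof.
move=> a0 r0.
by rewrite symMl ?expf_neq0 // expr2 symMl // cohomology_addxx addr0.
Qed.

Lemma val_unit_neq0 (u : valring v) : residue u != 0 -> val u != 0.
Proof. by rewrite residue_eq0 unfold_in negb_or => /andP[]. Qed.

Section ResidueMap.
Variables (k : sepClosure (residue_field v)) (dv : {additive H K 2 -> H k 1}).
Hypothesis dv_res : is_residue_hom dv.
Variable p : F.
Hypotheses (p0 : p != 0) (vp : v p = 1).

Let chi (u : valring v) : H k 1 := symbol k (fun=> residue u).

Lemma residue_units (u w : valring v) : residue u != 0 -> residue w != 0 ->
  dv (sym (val u) (val w)) = 0.
Proof.
move=> u0 w0; have [h _] := dv_res.
have := h (ucons u (fun=> w)); rewrite symbol2E ucons0 ucons1; apply => i.
by rewrite /ucons; case: unliftP.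
Qed.

Lemma residue_prime_unit (w : valring v) : residue w != 0 ->
  dv (sym p (val w)) = chi w.
Proof. by move=> w0; have [_ h] := dv_res; exact: (h p (fun=> w)). Qed.

(** The residue on arbitrary symbols, by bilinearity from its values on units
and on a uniformizer paired with a unit. *)
Lemma residue_tame (m n : bool) (u w : valring v) (r s : F) :
  residue u != 0 -> residue w != 0 -> r != 0 -> s != 0 ->
  dv (sym (p ^+ m * val u * r ^+ 2) (p ^+ n * val w * s ^+ 2))
  = chi w *+ m + chi u *+ n + dv (sym p p) *+ (m && n).
Proof.
move=> u0 w0 r0 s0; have u0' := val_unit_neq0 u0; have w0' := val_unit_neq0 w0.
have pX0 (i : bool) : p ^+ i != 0 by rewrite expf_neq0.
rewrite sym_sq_l ?mulf_neq0 // symC sym_sq_l ?mulf_neq0 // symC.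
have symX (i : bool) b : sym (p ^+ i) b = sym p b *+ i.
  case: i; rewrite ?expr1 // expr0 mulr0n.
  by rewrite -[1]mulr1 symMl ?oner_eq0 // cohomology_addxx.
rewrite symMl // !symMr // !symX ![sym _ (p ^+ _)]symC !symX.
rewrite !raddfD !raddfMn /= residue_units // !residue_prime_unit // addr0.
rewrite -mulrnA mulnb [n && m]andbC.
by rewrite addrC addrCA addrC [chi u *+ n + _]addrC.
Qed.

End ResidueMap.

Lemma unramified_of_offdiag (a b : 'I_3 -> F) (c : H K 2) :
  (forall i, a i != 0) -> (forall i, b i != 0) ->
  (forall i j, i != j -> sym (a i) (b j) = 0) ->
  (forall i, sym (a i) (b i) = c) ->
  unramified_at v c.
Proof.
move=> a0 b0 off diag k dv dv_res.
have [p p0 vp] := dval_surj v.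
have /choice[m /choice[u /choice[r ar]]] i := unit_decomposition p0 vp (a0 i).
have /choice[n /choice[w /choice[s bs]]] i := unit_decomposition p0 vp (b0 i).
pose chi (x : valring v) : H k 1 := symbol k (fun=> residue x).
have dvE i j : dv (sym (a i) (b j))
    = chi (w j) *+ m i + chi (u i) *+ n j + dv (sym p p) *+ (m i && n j).
  have [u0 r0 ->] := ar i; have [w0 s0 ->] := bs j.
  exact: (residue_tame dv_res p0 vp).
apply: (@tame_form_eq0 (H k 1) m n
  (chi \o u) (chi \o w) (dv (sym p p))).
  by move=> i j ij; rewrite -dvE off // raddf0.
by move=> i; rewrite -dvE diag.
Qed.
End Residues.

(** * Real closures *)

Section RealClosures.
Variables (F : fieldType) (K : sepClosure F).
Hypothesis char2 : 2%N \notin [pchar F].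
Variables (R : rcfType) (rho : {rmorphism F -> R}) (L : sepClosure R).
Variables (j : {rmorphism K -> L}).
Hypothesis jE : forall a, j (sepclosure_in K a) = sepclosure_in L (rho a).

Lemma res_sym_ge0 (a b : F) : 0 <= rho a -> res jE (sym K a b) = 0.
Proof.
move=> a_ge0; have ra : rho a = Num.sqrt (rho a) ^+ 2 by rewrite sqr_sqrtr.
have triv s : kummer a (gal_res jE s) = 0.
  have [y yE] := sqrt_exists char2 (sepclosure_in K a).
  rewrite (kummerE _ yE).
  suff -> : gal_res jE s y = y by rewrite eqxx.
  apply: (fmorph_inj j); rewrite gal_resE.
  have : j y ^+ 2 = sepclosure_in L (Num.sqrt (rho a)) ^+ 2.
    by rewrite -!rmorphXn /= yE jE -ra.
  by move/eqP; rewrite eqf_sqr => /orP[] /eqP ->; rewrite ?rmorphN /= gal_in.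
rewrite /sym /symbol res_pi -(raddf0 (\pi_(H L 2))); congr \pi.
apply/val_inj/funext => s /=; rewrite /cochain_res cochain_symE /= triv.
by rewrite mul0r.
Qed.

Lemma res_sym_ge0r (a b : F) : 0 <= rho b -> res jE (sym K a b) = 0.
Proof. by rewrite symC; exact: res_sym_ge0. Qed.

Lemma killed_of_offdiag (a b : 'I_3 -> F) (c : H K 2) :
  is_norm (a ord0) (b ord_max) -> (forall i, sym K (a i) (b i) = c) ->
  res jE c = 0.
Proof.
move=> [[x y] /= e] diag.
have [a_ge0|a_lt0] := leP 0 (rho (a ord0)).
  by rewrite -(diag ord0) res_sym_ge0.
rewrite -(diag ord_max) res_sym_ge0r //.
rewrite e rmorphB rmorphXn (rmorphM rho) rmorphXn /=.
rewrite addr_ge0 ?sqr_ge0 // oppr_ge0 mulr_le0_ge0 ?sqr_ge0 //; exact: ltW.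
Qed.
End RealClosures.

(** * The theorem *)

(* K is an arbitrary separable closure of F, used to define Galois cohomology. *)
Theorem proposition10p1 (F : fieldType) (K : sepClosure F) :
  2%N \notin [pchar F] ->
  @Hu F K 1 = [set 0 : H K 2] ->
  tractable F.
Proof.
move=> char2 Hu0 a b a0 b0 off diag.
have two0 := two_neq0 char2.
pose c := sym K (a ord0) (b ord0).
have symE i : sym K (a i) (b i) = c by exact: isom_sym.
have off_norm i j : i != j -> is_norm (a i) (b j).
  by move=> ij; apply: split_is_norm => //; exact: off.
have c0 : c = 0.
  suff : [set 0 : H K 2] c by [].
  rewrite -Hu0; split=> [v _|P R rho _ _ L j jE].
    apply: (@unramified_of_offdiag F K char2 v a b) => // i j ij.
    exact/is_norm_sym_eq0/off_norm.
  by apply: (killed_of_offdiag char2 jE (off_norm ord0 ord_max isT) symE).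
move=> i; apply: is_norm_split => //.
by apply: (sym_eq0_is_norm (K := K)) => //; rewrite symE.
Qed.
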